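(* Let $\mu\in\mathcal{P}$ and let $(\mathbf{u}^*_h(\mu),\mathbf{E}^*_h(\mu),\mathbf{F}^*_h(\mu))\in\mathbf{U}_{ad}\times\mathcal{E}_h\times\mathcal{E}_h$ and $(\mathbf{u}^*_N(\mu),\mathbf{E}^*_N(\mu),\mathbf{F}^*_N(\mu))\in\mathbf{U}_{ad}\times\mathcal{E}_N\times\mathcal{E}_N$ satisfy the discrete optimality system on $(\mathcal{E}_h,V_h)$ and the reduced optimality system on $(\mathcal{E}_N,V_N)$, respectively. Then $$\left| J(\mathbf{u}^*_h,\mathbf{E}^*_h;\mu) - J(\mathbf{u}^*_N,\mathbf{E}^*_N;\mu) \right| \le \delta^J,$$ with \begin{align*} \delta^J &= \delta^J_{\mathbf{E}} \|R_{\mathbf{E}}(\cdot;\mu)\|_{\mathbf{H}(\mathbf{curl};\Omega)^*} + \delta^J_{\mathbf{F}} \|R_{\mathbf{F}}(\cdot;\mu)\|_{\mathbf{H}(\mathbf{curl};\Omega)^*},\\ \delta^J_{\mathbf{E}} &= C^\Omega_{\overline{\sigma}} \overline{\epsilon} \left( (C_\mathbf{E} + e_d) \left(C^\Omega_{\overline{\sigma}}\alpha^{-1/2} \underline{\epsilon}^{-1} \overline{\epsilon}^2 + 1\right) + \alpha^{1/2} \underline{\epsilon}^{-1} \overline{\epsilon}\left( \|\overline{\mathbf{u}}\|_{\mathbb{R}^3} |\Omega|^{1/2} + u_d \right)\right),\\ \delta^J_{\mathbf{F}} &= C^\Omega_{\overline{\sigma}} \overline{\epsilon}^2 \left( C^\Omega_{\overline{\sigma}}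 \alpha^{-1} \underline{\epsilon}^{-1} \overline{\epsilon} (C_\mathbf{E} + e_d) + \underline{\epsilon}^{-1} \left( \|\overline{\mathbf{u}}\|_{\mathbb{R}^3} |\Omega|^{1/2} + u_d \right)\right). \end{align*}
   Context: **Setting.** $\Omega\subset\mathbb{R}^3$ is open, bounded, connected with Lipschitz boundary; $\mathcal{P}\subset\mathbb{R}^p$ is compact; $D\subset\Omega$ is measurable; $\alpha>0$; $\mathbf{L}^2=(L^2)^3$. $\mathbf{H}(\mathbf{curl};\Omega)=\{\mathbf{\Phi}\in\mathbf{L}^2(\Omega): \nabla\times\mathbf{\Phi}\in\mathbf{L}^2(\Omega)\}$ has norm $\|\mathbf{\Phi}\|^2_{\mathbf{H}(\mathbf{curl};\Omega)}=\|\mathbf{\Phi}\|^2_{\mathbf{L}^2(\Omega)}+\|\nabla\times\mathbf{\Phi}\|^2_{\mathbf{L}^2(\Omega)}$, and $\mathbf{H}_0(\mathbf{curl};\Omega)$ is the closure of $\mathbf{C}_c^\infty(\Omega)$ in it. The scalar data satisfy $\underline{\rho}\le\rho(\mathbf{x};\mu)\le\overline{\rho}$, $\underline{\epsilon}\le\epsilon(\mathbf{x};\mu)\le\overline{\epsilon}$, $\underline{\sigma}\le\sigma(\mathbf{x};\mu)\le\overline{\sigma}$ for a.e. $\mathbf{x}\in\Omega$ and all $\mu\in\mathcal{P}$, with constants independent of $\mathbf{x},\mu$ and $\underline{\epsilon},\underline{\sigma}>0$; $\epsilon$ is piecewise smooth in $\mathbf{x}$. Admissible controls: $\mathbf{U}_{ad}=\{\mathbf{u}\in\mathbf{L}^2(\Omega):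 \nabla\cdot(\epsilon(\mu)\mathbf{u})=0 \text{ for all }\mu\in\mathcal{P},\ \underline{\mathbf{u}}\le\mathbf{u}\le\overline{\mathbf{u}}\}$ with given $\underline{\mathbf{u}},\overline{\mathbf{u}}\in\mathbb{R}^3$ (componentwise inequalities). Desired state and control: $\|\mathbf{E}_d(\mu)\|_{\mathbf{L}^2(D)}\le e_d$, $\|\mathbf{u}_d(\mu)\|_{\mathbf{L}^2(\Omega)}\le u_d$ for all $\mu\in\mathcal{P}$, and $\nabla\cdot(\epsilon(\mu)\mathbf{E}_d(\mu))=\rho(\mu)$ in $D$. The cost functional is $$J(\mathbf{u},\mathbf{E};\mu)=\tfrac12\|\sqrt{\epsilon(\mu)}(\mathbf{E}-\mathbf{E}_d(\mu))\|^2_{\mathbf{L}^2(D)}+\tfrac{\alpha}{2}\|\sqrt{\epsilon(\mu)}(\mathbf{u}-\mathbf{u}_d(\mu))\|^2_{\mathbf{L}^2(\Omega)}.$$ **Spaces.** $(\mathcal{T}_h)$ is a quasi-uniform family of regular triangulations of $\Omega$; $\mathcal{E}_h=\{\mathbf{E}_h\in\mathbf{H}_0(\mathbf{curl};\Omega): \mathbf{E}_h|_T=\mathbf{a}_T+\mathbf{b}_T\times\mathbf{x},\ \mathbf{a}_T,\mathbf{b}_T\in\mathbb{R}^3,\ \forall T\in\mathcal{T}_h\}$; $V_h=\{\phi_h\in H_0^1(\Omega):\phi_h|_T=a_T+\mathbf{b}_T\cdot\mathbf{x},\ a_T\in\mathbb{R},\mathbf{b}_T\in\mathbb{R}^3,\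 \forall T\in\mathcal{T}_h\}$. $\mathcal{E}_N\subset\mathcal{E}_h$ and $V_N\subset V_h$ are given reduced basis spaces. $C^\Omega_{\overline{\sigma}}>0$ is the coercivity constant: $\|\mathbf{v}\|^2_{\mathbf{H}(\mathbf{curl};\Omega)}\le C^\Omega_{\overline{\sigma}}(\sigma^{-1}(\mu)\nabla\times\mathbf{v},\nabla\times\mathbf{v})_{\mathbf{L}^2(\Omega)}$ for all $\mu\in\mathcal{P}$ and all $\mathbf{v}\in\mathcal{E}_h$ with $(\epsilon(\mu)\mathbf{v},\nabla\phi_h)_{\mathbf{L}^2(\Omega)}=0$ for all $\phi_h\in V_h$; the same coercivity condition is assumed on $(\mathcal{E}_N,V_N)$, i.e. for all $\mathbf{v}\in\mathcal{E}_N$ with $(\epsilon(\mu)\mathbf{v},\nabla\phi_N)_{\mathbf{L}^2(\Omega)}=0$ for all $\phi_N\in V_N$. **Constant $C_{\mathbf{E}}$.** $C_{\mathbf{E}}:=C^\Omega_{\overline{\epsilon},\overline{\sigma}}|\Omega|^{1/2}(\overline{\rho}+\|\overline{\mathbf{u}}\|_{\mathbb{R}^3})$, where $C^\Omega_{\overline{\epsilon},\overline{\sigma}}>0$ is the stability constant in $\|\mathbf{E}\|_{\mathbf{H}(\mathbf{curl};\Omega)}\le C^\Omega_{\overline{\epsilon},\overline{\sigma}}(\|\mathbf{u}\|_{\mathbf{L}^2(\Omega)}+\|\rho\|_{L^2(\Omega)})\le C_{\mathbf{E}}$ for the solution $\mathbf{E}$ of the state equations with control $\mathbf{u}\in\mathbf{U}_{ad}$;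 the state equations are the first two equations of the system below, posed on $(\mathbf{H}_0(\mathbf{curl};\Omega),H_0^1(\Omega))$, and the same bound by $C_{\mathbf{E}}$ is used for their solutions on $(\mathcal{E}_h,V_h)$ and on $(\mathcal{E}_N,V_N)$. $|\Omega|$ is the Lebesgue measure of $\Omega$, $\|\cdot\|_{\mathbb{R}^3}$ the Euclidean norm. **Optimality systems.** For $\bullet\in\{h,N\}$, the optimality system on $(\mathcal{E}_\bullet,V_\bullet)$ (called discrete for $\bullet=h$, reduced for $\bullet=N$) for $(\mathbf{u}^*_\bullet,\mathbf{E}^*_\bullet,\mathbf{F}^*_\bullet)\in\mathbf{U}_{ad}\times\mathcal{E}_\bullet\times\mathcal{E}_\bullet$ is: for all $(\mathbf{\Phi},\phi,\mathbf{u})\in\mathcal{E}_\bullet\times V_\bullet\times\mathbf{U}_{ad}$ (dependence on $\mu$ suppressed), \begin{align*} &(\sigma^{-1}\nabla\times\mathbf{E}^*_\bullet,\nabla\times\mathbf{\Phi})_{\mathbf{L}^2(\Omega)}=(\epsilon\mathbf{u}^*_\bullet,\mathbf{\Phi})_{\mathbf{L}^2(\Omega)},\qquad (\epsilon\mathbf{E}^*_\bullet,\nabla\phi)_{\mathbf{L}^2(\Omega)}=-(\rho,\phi)_{L^2(\Omega)},\\ &(\sigma^{-1}\nabla\times\mathbf{F}^*_\bullet,\nabla\times\mathbf{\Phi})_{\mathbf{L}^2(\Omega)}=(\epsilon(\mathbf{E}^*_\bullet-\mathbf{E}_d),\mathbf{\Phi})_{\mathbf{L}^2(D)},\qquad (\epsilon\mathbf{F}^*_\bullet,\nabla\phi)_{\mathbf{L}^2(\Omega)}=0,\\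 &\left(\epsilon(\mathbf{u}-\mathbf{u}^*_\bullet),\mathbf{u}_d-\tfrac1\alpha\mathbf{F}^*_\bullet-\mathbf{u}^*_\bullet\right)_{\mathbf{L}^2(\Omega)}\le0. \end{align*} **Auxiliary fields.** $\widehat{\mathbf{E}}_h(\mu),\widehat{\mathbf{F}}_h(\mu)\in\mathcal{E}_h$ are assumed to be defined by: for all $(\mathbf{\Phi}_h,\phi_h)\in\mathcal{E}_h\times V_h$, $(\sigma^{-1}\nabla\times\widehat{\mathbf{E}}_h,\nabla\times\mathbf{\Phi}_h)_{\mathbf{L}^2(\Omega)}=(\epsilon\mathbf{u}^*_N,\mathbf{\Phi}_h)_{\mathbf{L}^2(\Omega)}$, $(\epsilon\widehat{\mathbf{E}}_h,\nabla\phi_h)_{\mathbf{L}^2(\Omega)}=-(\rho,\phi_h)_{L^2(\Omega)}$; and $(\sigma^{-1}\nabla\times\widehat{\mathbf{F}}_h,\nabla\times\mathbf{\Phi}_h)_{\mathbf{L}^2(\Omega)}=(\epsilon(\mathbf{E}^*_N-\mathbf{E}_d),\mathbf{\Phi}_h)_{\mathbf{L}^2(D)}$, $(\epsilon\widehat{\mathbf{F}}_h,\nabla\phi_h)_{\mathbf{L}^2(\Omega)}=0$. **Residuals.** $R_{\mathbf{E}}(\cdot;\mu),R_{\mathbf{F}}(\cdot;\mu)\in\mathcal{E}_h^*$ are given for $\mathbf{\Phi}_h\in\mathcal{E}_h$ by \begin{align*} R_{\mathbf{E}}(\mathbf{\Phi}_h;\mu)&=(\epsilon(\mu)\mathbf{u}^*_N(\mu),\mathbf{\Phi}_h)_{\mathbf{L}^2(\Omega)}-(\sigma^{-1}(\mu)\nabla\times\mathbf{E}^*_N(\mu),\nabla\times\mathbf{\Phi}_h)_{\mathbf{L}^2(\Omega)},\\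 R_{\mathbf{F}}(\mathbf{\Phi}_h;\mu)&=(\epsilon(\mu)(\mathbf{E}^*_N(\mu)-\mathbf{E}_d(\mu)),\mathbf{\Phi}_h)_{\mathbf{L}^2(D)}-(\sigma^{-1}(\mu)\nabla\times\mathbf{F}^*_N(\mu),\nabla\times\mathbf{\Phi}_h)_{\mathbf{L}^2(\Omega)}, \end{align*} and $\|R\|_{\mathbf{H}(\mathbf{curl};\Omega)^*}$ is the dual norm on $\mathcal{E}_h^*$ when $\mathcal{E}_h$ carries the $\mathbf{H}(\mathbf{curl};\Omega)$ norm. *)

(* Defs.v *)
From HB Require Import structures.
From mathcomp Require Import all_boot all_order all_algebra.
From mathcomp Require Import all_classical all_reals all_analysis.

Set Implicit Arguments.
Unset Strict Implicit.
Unset Printing Implicit Defensive.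

Import Order.TTheory GRing.Theory Num.Theory.
Import numFieldNormedType.Exports.

Local Open Scope classical_set_scope.
Local Open Scope ring_scope.

(* Points of R^3 and vectors of R^3 are both row vectors; the library topology
   of 'rV[R]_3 is given by the sup norm, hence is the Euclidean one. *)
Notation sfield R := ('rV[R]_3 -> R).
Notation vfield R := ('rV[R]_3 -> 'rV[R]_3).

(* Lebesgue measure on R^3, on the full Lebesgue sigma-algebra: the library has
   a product measure on the Borel sets of R * R * R; we take its outer measure,
   carry it to 'rV[R]_3, and use the Caratheodory-measurable sets. *)
Section Lebesgue3.
Context {R : realType}.

Definition row3 (p : R * R * R) : 'rV[R]_3 :=
  \row_i [:: p.1.1; p.1.2; p.2]`_i.

Definition box_measure :=
  ((@lebesgue_measure R \x @lebesgue_measure R) \x @lebesgue_measure R)%E.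

Definition outer3 (A : set 'rV[R]_3) : \bar R :=
  (box_measure^*)%mu (row3 @^-1` A).

Let outer3_0 : outer3 set0 = 0%E.
Proof. by rewrite /outer3 preimage_set0 outer_measure0. Qed.

Let outer3_ge0 A : (0 <= outer3 A)%E.
Proof. exact: outer_measure_ge0. Qed.

Let le_outer3 : {homo outer3 : A B / A `<=` B >-> (A <= B)%E}.
Proof. by move=> A B AB; apply: le_outer_measure => x /AB. Qed.

Let outer3_sigma_subadditive : sigma_subadditive outer3.
Proof.
by move=> F; rewrite /outer3 preimage_bigcup; exact: outer_measure_sigma_subadditive.
Qed.

HB.instance Definition _ := isOuterMeasure.Build R _ outer3
  outer3_0 outer3_ge0 le_outer3 outer3_sigma_subadditive.

Definition leb_outer3 : {outer_measure set 'rV[R]_3 -> \bar R} := outer3.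

Definition leb3 : {measure set (caratheodory_type leb_outer3) -> \bar R} :=
  leb_outer3.

End Lebesgue3.
Notation R3L R := (caratheodory_type (@leb_outer3 R)).

Section Setting.
Context {R : realType}.
Implicit Types (A D O Om : set 'rV[R]_3) (f phi s sigma eps rho : sfield R).
Implicit Types (u v w E F G psi Ed ud : vfield R) (X : set (vfield R)).

Definition dot (a b : 'rV[R]_3) : R := \sum_i a 0 i * b 0 i.

Definition enorm (a : 'rV[R]_3) : R := Num.sqrt (dot a a).

(* 'I_3 is Z/3, so the indices i + 1 and i + 2 are cyclic. *)
Definition cross (a b : 'rV[R]_3) : 'rV[R]_3 :=
  \row_i (a 0 (i + 1) * b 0 (i + 2) - a 0 (i + 2) * b 0 (i + 1)).

Definition smul s v : vfield R := fun x => s x *: v x.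

Definition vcoord v (i : 'I_3) : sfield R := fun x => v x 0 i.

Definition partial (i : 'I_3) f : sfield R := 'D_(delta_mx 0 i) f.

Definition grad phi : vfield R := fun x => \row_i partial i phi x.

Definition curl psi : vfield R := fun x =>
  \row_i (partial (i + 1) (vcoord psi (i + 2)) x -
          partial (i + 2) (vcoord psi (i + 1)) x).

Definition smooth_on O f := forall (l : seq 'I_3) x, O x ->
  {for x, continuous (foldr partial f l)} /\
  forall i, derivable (foldr partial f l) x (delta_mx 0 i).

Definition test_fun O phi :=
  [/\ smooth_on setT phi,
      compact (closure [set x | phi x != 0]) &
      closure [set x | phi x != 0] `<=` O].

Definition test_field O psi := forall i, test_fun O (vcoord psi i).

Definition lmeasurable A := measurable (A : set (R3L R)).

Definition lmeasurable_fun A f :=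
  measurable_fun (A : set (R3L R)) (f : R3L R -> R).

Definition L2 A f :=
  lmeasurable_fun A f /\
  leb3.-integrable A (fun x => (f x ^+ 2)%:E).

Definition vL2 A v := forall i, L2 A (vcoord v i).

Definition ip A f (g : sfield R) : R := (\int[leb3]_(x in A) (f x * g x))%R.

Definition vip A u v : R := (\int[leb3]_(x in A) dot (u x) (v x))%R.

Definition L2norm A f : R := Num.sqrt (ip A f f).

Definition vL2norm A v : R := Num.sqrt (vip A v v).

Definition vol A : R := fine (leb3 A).

(* [wgrad Om] and [wcurl Om] pick a representative of the
    weak derivative, which is unique up to a null set; they are 0 if there is
    no weak derivative in L^2. *)

Definition is_wgrad Om phi v := forall (psi : sfield R) i, test_fun Om psi ->
  ip Om phi (partial i psi) = - ip Om (vcoord v i) psi.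

Definition is_wcurl Om E v := forall psi, test_field Om psi ->
  vip Om E (curl psi) = vip Om v psi.

Definition wgrad Om phi : vfield R :=
  xget 0 [set v | vL2 Om v /\ is_wgrad Om phi v].

Definition wcurl Om E : vfield R :=
  xget 0 [set v | vL2 Om v /\ is_wcurl Om E v].

Definition H1 Om : set (sfield R) :=
  [set phi | L2 Om phi /\ exists v, vL2 Om v /\ is_wgrad Om phi v].

Definition H1norm Om phi : R :=
  Num.sqrt (L2norm Om phi ^+ 2 + vL2norm Om (wgrad Om phi) ^+ 2).

Definition H10 Om : set (sfield R) :=
  [set phi | H1 Om phi /\ forall e, 0 < e ->
    exists2 psi : sfield R, test_fun Om psi & H1norm Om (phi - psi) < e].

Definition Hcurl Om : set (vfield R) :=
  [set E | vL2 Om E /\ exists v, vL2 Om v /\ is_wcurl Om E v].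

Definition Hcurl_norm Om E : R :=
  Num.sqrt (vL2norm Om E ^+ 2 + vL2norm Om (wcurl Om E) ^+ 2).

Definition H0curl Om : set (vfield R) :=
  [set E | Hcurl Om E /\ forall e, 0 < e ->
    exists2 psi, test_field Om psi & Hcurl_norm Om (E - psi) < e].

(* div v = f in A, in the sense of distributions; the test functions have
   compact support in A, which need not be open. *)
Definition wdiv_eq A v f := forall phi, test_fun A phi ->
  vip A v (grad phi) = - ip A f phi.

(* Near each boundary point, in rotated coordinates y, the set is the strict
   epigraph of a Lipschitz function of (y_0, y_1). *)
Definition lipschitz_boundary Om := forall p, (closure Om `\` Om°) p ->
  exists (Q : 'M[R]_3) (r : R) (g : R * R -> R),
    [/\ Q *m Q^T = 1%:M, 0 < r, lipschitz g &
     forall x, ball p r x ->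
       let y := (x - p) *m Q in Om x <-> g (y 0 0, y 0 1) < y 0 2].

(* The pieces may depend on f; f is smooth in each open piece. *)
Definition piecewise_smooth Om f :=
  exists (n : nat) (O : 'I_n -> set 'rV[R]_3),
    [/\ forall k, open (O k) /\ O k `<=` Om,
        trivIset setT O,
        leb3.-negligible (Om `\` \bigcup_k O k) &
        forall k, smooth_on (O k) f].

Definition hull (l : seq 'rV[R]_3) : set 'rV[R]_3 :=
  [set x | exists w : 'I_(size l) -> R,
    [/\ forall i, 0 <= w i, \sum_i w i = 1 & x = \sum_i w i *: l`_i]].

Definition diam A : R :=
  sup [set d | exists x y, [/\ A x, A y & d = enorm (x - y)]].

Definition inball_diam A : R :=
  sup [set d | exists (c : 'rV[R]_3) (r : R),
    [/\ 0 <= r, (forall x, enorm (x - c) <= r -> A x) & d = 2 * r]].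

(* A tetrahedron is given by its vertices. *)
Definition mesh := seq (4.-tuple 'rV[R]_3).

(* Two tetrahedra meet in the hull of their common vertices, i.e. in a common
   face, edge, vertex, or not at all. *)
Definition triangulation Om (T : mesh) :=
  [/\ forall t : 4.-tuple _, t \in T -> (hull t)° !=set0,
      [set x | exists2 t : 4.-tuple _, t \in T & hull t x] = closure Om &
      forall t t' : 4.-tuple _, t \in T -> t' \in T ->
        hull t `&` hull t' = hull [seq p <- t | p \in tval t']].

Definition quasi_uniform_family (I : Type) Om (T : I -> mesh) :=
  (forall h, triangulation Om (T h)) /\
  exists kappa c : R, [/\ 0 < kappa, 0 < c &
    forall h (t t' : 4.-tuple _), t \in T h -> t' \in T h ->
      diam (hull t) <= kappa * inball_diam (hull t) /\
      c * diam (hull t') <= diam (hull t)].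

Definition nedelec_space Om (T : mesh) : set (vfield R) :=
  [set E | H0curl Om E /\ forall t : 4.-tuple _, t \in T ->
    exists a b : 'rV[R]_3,
      {ae leb3, forall x, hull t x -> E x = a + cross b x}].

Definition lagrange_space Om (T : mesh) : set (sfield R) :=
  [set phi | H10 Om phi /\ forall t : 4.-tuple _, t \in T ->
    exists (a : R) (b : 'rV[R]_3),
      {ae leb3, forall x, hull t x -> phi x = a + dot b x}].

Definition linear_subspace (V : lmodType R) (X : set V) :=
  X 0 /\ forall (a : R) (x y : V), X x -> X y -> X (a *: x + y).

(* Below, X is a space of fields, Y a space of scalar
    functions, and sigma, eps, rho, Ed, ud are the data at a fixed
    parameter. *)

Definition Uad (p : nat) (P : set 'rV[R]_p) Om (eps : 'rV[R]_p -> sfield R)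
    (ulo uhi : 'rV[R]_3) : set (vfield R) :=
  [set u | [/\ vL2 Om u,
    forall mu, P mu -> wdiv_eq Om (smul (eps mu) u) (fun=> 0) &
    {ae leb3, forall x, Om x -> forall i, ulo 0 i <= u x 0 i <= uhi 0 i}]].

Definition recip f : sfield R := fun x => (f x)^-1.

(* (sigma^-1 curl E, curl G) on Om *)
Definition curl_form Om sigma E G : R :=
  vip Om (smul (recip sigma) (wcurl Om E)) (wcurl Om G).

Definition div_constraint Om (Y : set (sfield R)) eps E rho :=
  forall phi, Y phi -> vip Om (smul eps E) (wgrad Om phi) = - ip Om rho phi.

Definition coercive Om X (Y : set (sfield R)) sigma eps (C : R) :=
  forall v, X v -> div_constraint Om Y eps v (fun=> 0) ->
    Hcurl_norm Om v ^+ 2 <= C * curl_form Om sigma v v.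

Definition state_system Om X (Y : set (sfield R)) sigma eps rho u E :=
  [/\ X E,
      forall G, X G -> curl_form Om sigma E G = vip Om (smul eps u) G &
      div_constraint Om Y eps E rho].

Definition adjoint_system Om D X (Y : set (sfield R)) sigma eps Ed E F :=
  [/\ X F,
      forall G, X G ->
        curl_form Om sigma F G = vip D (smul eps (E - Ed)) G &
      div_constraint Om Y eps F (fun=> 0)].

Definition optimality_system Om D (U : set (vfield R)) X (Y : set (sfield R))
    (alpha : R) sigma eps rho Ed ud u E F :=
  [/\ U u,
      state_system Om X Y sigma eps rho u E,
      adjoint_system Om D X Y sigma eps Ed E F &
      forall w, U w ->
        vip Om (smul eps (w - u)) (ud - alpha^-1 *: F - u) <= 0].

Definition sqrt_fun f : sfield R := fun x => Num.sqrt (f x).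

Definition cost Om D (alpha : R) eps Ed ud u E : R :=
  2^-1 * vL2norm D (smul (sqrt_fun eps) (E - Ed)) ^+ 2 +
  alpha / 2 * vL2norm Om (smul (sqrt_fun eps) (u - ud)) ^+ 2.

Definition state_residual Om sigma eps u E : vfield R -> R :=
  fun G => vip Om (smul eps u) G - curl_form Om sigma E G.

Definition adjoint_residual Om D sigma eps Ed E F : vfield R -> R :=
  fun G => vip D (smul eps (E - Ed)) G - curl_form Om sigma F G.

Definition dual_norm Om X (r : vfield R -> R) : R :=
  sup [set `|r G| | G in [set G | X G /\ Hcurl_norm Om G <= 1]].

End Setting.

(* Main.v *)
Require Import Defs.
From HB Require Import structures.
From mathcomp Require Import all_boot all_order all_algebra.
From mathcomp Require Import all_classical all_reals all_analysis.
From mathcomp Require Import measurable_realfun ring lra.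

(* Let a = E_N - Ehat, s = E_h - Ehat and let A be the curl-curl form. Testing
   the adjoint equations of F_h and Fhat with a gives A(F_h, a) and A(Fhat, a),
   which are values of the residual R_E at F_h and Fhat. Hence the observation
   terms (eps (E_h - E_d), a)_D and (eps (E_N - E_d), a)_D are bounded by
   |R_E| times the a priori bound C c (C_E + e_d) of the adjoint fields, and no
   discrete divergence constraint on a is required.
   Expanding the quadratic cost at one optimum, the terms linear in s cancel
   against the variational inequality of that optimum. At (u_h, E_h) this bounds
   J_h - J_N by the a term alone. At (u_N, E_N) it leaves the inconsistency
   (eps (u_h - u_N), F_N - Fhat), which is R_F(s) up to sign; it is split between
   |R_F| and the quadratic term in u_h - u_N of the cost by Young's inequality.
   The linearity of the weak curl needed for A to be bilinear comes from its
   uniqueness, i.e. from the fundamental lemma of the calculus of variations in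
   R^3 with explicit bump functions, and from integration by parts. *)

Set Implicit Arguments.
Unset Strict Implicit.
Unset Printing Implicit Defensive.

Import Order.TTheory GRing.Theory Num.Theory.
Import numFieldNormedType.Exports.

Local Open Scope classical_set_scope.
Local Open Scope ring_scope.

(** * Square-integrable functions and positive forms *)

(** Coercivity says nothing about a: E_N obeys the divergence equation only against V_N, so a need
    not be weighted-orthogonal to the gradients of V_h. The adjoint fields do satisfy the constraint
    of their own pair of spaces, which is why the error is transferred to them. The same defect
    affects F_N - Fhat, for which only the sum of two a priori bounds is at hand. In contrast s is a
    difference of two solutions on (E_h, V_h) with the same rho, so coercivity bounds it by the
    control difference. With B = C_E + e_d and c the upper bound of eps, the two one-sided estimates
    are C c B |R_E| and C c B |R_E| + C^2 c^2 B |R_F| / alpha; the ratio of the bounds of eps is at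
    least 1, which places both below delta^J. On the analytic side, [leb3] lives on the Caratheodory
    sets, while Fubini and generating boxes belong to the Borel product. Continuous integrands are
    moved along [unrow3], and Lebesgue sets are replaced by Borel hulls. *)

Section SquareIntegrable.
Context d (T : measurableType d) {R : realType}.
Variables (mu : {measure set T -> \bar R}) (A : set T).
Hypothesis mA : measurable A.
Implicit Types f g q : T -> R.

Definition square_integrable f :=
  measurable_fun A f /\ mu.-integrable A (fun x => (f x ^+ 2)%:E).

Lemma integrable_ae_le f g : measurable_fun A f ->
  mu.-integrable A (EFin \o g) ->
  {ae mu, forall x, A x -> `|f x| <= g x} -> mu.-integrable A (EFin \o f).
Proof.
move=> mf ig fg; apply/integrableP; split; first exact/measurable_EFinP.
case/integrableP : ig => mg; apply: le_lt_trans.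
apply: ae_ge0_le_integral => //.
- by apply: measurableT_comp => //; exact/measurable_EFinP.
- exact: measurableT_comp.
apply: filterS fg => x fg Ax /=.
by rewrite lee_fin (le_trans (fg Ax))// ler_norm.
Qed.

Lemma square_integrableM f g : square_integrable f -> square_integrable g ->
  mu.-integrable A (EFin \o (fun x => f x * g x)).
Proof.
move=> [mf if2] [mg ig2].
have i2 := integrableD mA if2 ig2.
apply: (le_integrable mA _ _ i2).
  exact/measurable_EFinP/measurable_funM.
move=> x _ /=; rewrite lee_fin normrM [leRHS]ger0_norm ?addr_ge0 ?sqr_ge0//.
rewrite -(real_normK (num_real (f x))) -(real_normK (num_real (g x))).
move: `|f x| `|g x| (normr_ge0 (f x)) (normr_ge0 (g x)) => a b a0 b0.
by have ab := mulr_ge0 a0 b0; have := sqr_ge0 (a - b); rewrite sqrrB; lra.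
Qed.

Lemma square_integrable0 : square_integrable (fun=> 0).
Proof.
split; first exact: measurable_cst.
rewrite [X in integrable _ _ X](_ : _ = cst 0%E) ?integrable0//.
by apply/funext => x /=; rewrite expr0n.
Qed.

Lemma square_integrable_lin (a : R) f g : square_integrable f -> square_integrable g ->
  square_integrable (fun x => a * f x + g x).
Proof.
move=> sf sg; have [mf if2] := sf; have [mg ig2] := sg.
split.
  by apply: measurable_funD => //; apply: measurable_funM => //; exact: measurable_cst.
have i1 := integrableZl mA (a ^+ 2) if2.
have i2 := integrableZl mA (a *+ 2) (square_integrableM sf sg).
apply: eq_integrable (integrableD mA (integrableD mA i1 i2) ig2) => //= x _.
by rewrite -!EFinM -!EFinD; congr EFin; ring.
Qed.

Lemma square_integrable_mull q f c : measurable_fun A q ->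
  {ae mu, forall x, A x -> `|q x| <= c} -> square_integrable f ->
  square_integrable (fun x => q x * f x).
Proof.
move=> mq qc [mf if2]; split; first exact: measurable_funM.
have i1 := integrableZl mA (c ^+ 2) if2.
apply: (@integrable_ae_le (fun x => (q x * f x) ^+ 2)
  (fun x => c ^+ 2 * f x ^+ 2)) => //.
  exact/measurable_funX/measurable_funM.
apply: filterS qc => x /[apply] qc.
rewrite ger0_norm ?sqr_ge0// exprMn ler_wpM2r ?sqr_ge0//.
by rewrite -(real_normK (num_real (q x))) lerXn2r ?nnegrE// (le_trans _ qc).
Qed.

Lemma ae_eq_Rintegral f g : measurable_fun A f -> measurable_fun A g ->
  {ae mu, forall x, A x -> f x = g x} ->
  \int[mu]_(x in A) f x = \int[mu]_(x in A) g x.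
Proof.
move=> mf mg fg; congr fine; apply: ae_eq_integral => //.
- exact/measurable_EFinP.
- exact/measurable_EFinP.
by apply: filterS fg => x fg Ax /=; rewrite fg.
Qed.

Lemma ae_le_Rintegral f g : mu.-integrable A (EFin \o f) ->
  mu.-integrable A (EFin \o g) -> {ae mu, forall x, A x -> f x <= g x} ->
  \int[mu]_(x in A) f x <= \int[mu]_(x in A) g x.
Proof.
move=> fi gi fg.
have mf : measurable_fun A f by apply/measurable_EFinP; exact: measurable_int fi.
have mg : measurable_fun A g by apply/measurable_EFinP; exact: measurable_int gi.
have ai : mu.-integrable A (EFin \o (fun x => `|g x - f x|)).
  exact: integrable_norm (integrableB mA gi fi).
rewrite -subr_ge0 -RintegralB//.
(* The integrand is nonnegative only almost everywhere; its absolute value agrees with it up to a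
   null set and is nonnegative everywhere. *)
rewrite (@ae_eq_Rintegral _ (fun x => `|g x - f x|)).
- by apply: Rintegral_ge0.
- exact: measurable_funB.
- by apply/measurable_EFinP; exact: measurable_int ai.
by apply: filterS fg => x /[apply] fg; rewrite ger0_norm ?subr_ge0.
Qed.

End SquareIntegrable.

Lemma square_integrableS d (T : measurableType d) (R : realType)
    (mu : {measure set T -> \bar R}) (A B : set T) (f : T -> R) :
  measurable A -> measurable B -> B `<=` A ->
  square_integrable mu A f -> square_integrable mu B f.
Proof.
move=> mA mB BA [mf if2]; split; first exact: measurable_funS mf.
exact: integrableS if2.
Qed.

(** Positivity along the line [t *: u + v], taken at the minimiser [t = - B u v / B u u]. The
    carrier [S] is there because integral forms are bilinear only on square-integrable fields, not
    on all functions. *)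
Lemma form_cauchy_schwarz (R : realFieldType) (V : lmodType R) (S : set V) (B : V -> V -> R) :
  (forall a u v, S u -> S v -> S (a *: u + v)) ->
  (forall a u v w, S u -> S v -> S w -> B (a *: u + v) w = a * B u w + B v w) ->
  (forall u v, S u -> S v -> B u v = B v u) ->
  (forall u, S u -> 0 <= B u u) ->
  forall u v, S u -> S v -> B u v ^+ 2 <= B u u * B v v.
Proof.
move=> Sl Bl Bs B0 u v Su Sv.
have E t : B (t *: u + v) (t *: u + v) = t ^+ 2 * B u u + t * B u v *+ 2 + B v v.
  have St := Sl t _ _ Su Sv.
  rewrite Bl// (Bs u)// (Bs v)// !Bl// (Bs v u)//; ring.
have P t : 0 <= t ^+ 2 * B u u + t * B u v *+ 2 + B v v by rewrite -E; exact/B0/Sl.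
have [u0|u0] := eqVneq (B u u) 0.
  rewrite u0 mul0r; have [->|uv0] := eqVneq (B u v) 0; first by rewrite expr0n.
  (* With [B u u = 0] the quadratic is affine in [t], and this [t] is the one that gives it the
     value -1. *)
  have := P (- (B v v + 1) / (2 * B u v)); rewrite u0 mulr0 add0r => H.
  suff : (- (B v v + 1) / (2 * B u v) * B u v *+ 2 + B v v) = -1 :> R by move=> E1; lra.
  by field.
have up : 0 < B u u by rewrite lt_def u0 B0.
have := P (- B u v / B u u).
have -> : (- B u v / B u u) ^+ 2 * B u u + - B u v / B u u * B u v *+ 2 + B v v =
  (B u u * B v v - B u v ^+ 2) / B u u by field.
by rewrite pmulr_lge0 ?invr_gt0// subr_ge0.
Qed.

(** * The Borel structure of the completed Lebesgue measure of R^3 *)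

(** Intersect covers whose excess is at most [1/(n+1)]; finiteness is what lets the infimum be
    approached within a positive margin. *)
Lemma mu_ext_hull d (T : measurableType d) (R : realType)
    (mu : {measure set T -> \bar R}) (E : set T) : ((mu^*)%mu E < +oo)%E ->
  exists B, [/\ measurable B, E `<=` B & mu B = (mu^*)%mu E].
Proof.
move=> Eoo.
have Efin : (mu^*)%mu E \is a fin_num by rewrite ge0_fin_numE// outer_measure_ge0.
have /choice[C HC] (n : nat) : exists C, [/\ measurable C, E `<=` C &
    (mu C <= (mu^*)%mu E + (n.+1%:R^-1)%:E)%E].
  have n0 : 0 < n.+1%:R^-1 :> R by rewrite invr_gt0.
  have [_/= [A [mA EA] <-] Alt] := lb_ereal_inf_adherent n0 Efin.
  exists (\bigcup_k A k); split => //.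
    by apply: bigcupT_measurable => k; exact: mA.
  apply: (le_trans _ (ltW Alt)).
  by apply: measure_sigma_subadditive => //; apply: bigcupT_measurable => k; exact: mA.
exists (\bigcap_n C n).
have mC : measurable (\bigcap_n C n).
  by apply: bigcapT_measurable => n; have [] := HC n.
have EC : E `<=` \bigcap_n C n by move=> x Ex n _; have [_ + _] := HC n; exact.
split => //; apply/eqP; rewrite eq_le; apply/andP; split.
  apply/lee_addgt0Pr => e e0.
  have [n ne] : exists n : nat, n.+1%:R^-1 < e.
    have := near_infty_natSinv_lt (PosNum e0); case=> n _ /(_ n (leqnn n)) /= H.
    by exists n.
  have [mCn _ Cn] := HC n.
  apply: (@le_trans _ _ (mu (C n))); first by apply: le_measure; rewrite ?inE//; exact: bigcap_inf.
  by apply: (le_trans Cn); rewrite leeD2l// lee_fin ltW.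
by rewrite -[leRHS](measurable_mu_extE mu mC); exact: le_outer_measure.
Qed.

Lemma negligible_countable_bigcup d (T : measurableType d) (R : realType)
    (mu : {measure set T -> \bar R}) (I : countType) (F : I -> set T) :
  (forall i, mu.-negligible (F i)) -> mu.-negligible (\bigcup_i F i).
Proof.
move=> F0; pose G n := if unpickle n is Some i then F i else set0.
apply: (@negligibleS _ _ _ _ (\bigcup_n G n)).
  by move=> x [i _ Fix]; exists (pickle i) => //; rewrite /G pickleK.
apply: negligible_bigcup => n; rewrite /G; case: unpickle => [i|]; first exact: F0.
exact: negligible_set0.
Qed.

(* Dynkin's pi-lambda argument: the sets on which an integral vanishes form a
   lambda-system. *)
Lemma integral_pi_system_eq0 d (T : measurableType d) d' (T' : measurableType d')
    (R : realType) (mu : {measure set T -> \bar R}) (phi : T -> T') (G : set (set T'))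
    (Q : set T) (v : T -> R) :
  measurable_fun setT phi -> @measurable _ T' = <<s G >> -> setI_closed G ->
  measurable Q -> mu.-integrable Q (EFin \o v) ->
  (\int[mu]_(x in Q) (v x)%:E = 0)%E ->
  (forall A, G A -> \int[mu]_(x in Q `&` phi @^-1` A) (v x)%:E = 0)%E ->
  forall A, measurable A -> (\int[mu]_(x in Q `&` phi @^-1` A) (v x)%:E = 0)%E.
Proof.
move=> mphi GE GI mQ vi vQ vG A mA.
have mpre S : measurable S -> measurable (Q `&` phi @^-1` S).
  by move=> mS; apply: measurableI => //; rewrite -[X in measurable X]setTI; exact: mphi.
apply: (@dynkin_induction _ T' G
  (fun A => (\int[mu]_(x in Q `&` phi @^-1` A) (v x)%:E = 0)%E)) => //.
- by rewrite preimage_setT setIT.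
- move=> S mS S0.
  have : (\int[mu]_(x in (Q `&` phi @^-1` S) `|` (Q `&` phi @^-1` (~` S))) (v x)%:E = 0)%E.
    by rewrite -setIUr preimage_setC setUCr setIT.
  rewrite integral_setU_EFin//=.
  + by rewrite S0 add0e.
  + exact: mpre.
  + by apply: mpre; exact: measurableC.
  + by rewrite -setIUr preimage_setC setUCr setIT; exact/measurable_EFinP/(measurable_int _ vi).
  + by apply/disj_setPS => x [[_ Sx] [_]].
- move=> F mF tF F0; rewrite preimage_bigcup setI_bigcupr integral_bigcup.
  + by rewrite eseries0// => i _ _; rewrite F0.
  + by move=> i j _ _ [x [[_ Fi] [_ Fj]]]; apply: (tF i j) => //; exists (phi x).
  + by move=> k; exact: mpre.
  + apply: (integrableS mQ) => //; first by apply: bigcupT_measurable => k; exact: mpre.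
    by move=> x [k _ []].
- by rewrite -GE.
Qed.

Section LebesgueR3.
Context {R : realType}.
(* [box_measure] lives on the product of the types carrying [lebesgue_measure],
   whose display differs from the default one of [R]. *)
Local Notation mR := (measurableTypeR R).
Local Notation mR3 := (mR * mR * mR)%type.

Definition unrow3 (x : 'rV[R]_3) : mR3 := (x 0 0, x 0 1, x 0 2).

Lemma forall_ord3 (P : 'I_3 -> Prop) : P 0 -> P 1 -> P 2 -> forall i, P i.
Proof.
move=> P0 P1 P2 [[|[|[|//]]] lt3].
- by rewrite (_ : Ordinal lt3 = 0)//; exact: val_inj.
- by rewrite (_ : Ordinal lt3 = 1)//; exact: val_inj.
- by rewrite (_ : Ordinal lt3 = 2)//; exact: val_inj.
Qed.

Lemma unrow3K : cancel unrow3 row3.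
Proof. by move=> x; apply/rowP; apply: forall_ord3; rewrite !mxE. Qed.

Lemma row3K : cancel row3 unrow3.
Proof. by move=> [[a b] c]; rewrite /unrow3 !mxE. Qed.

Lemma outer3E (A : set 'rV[R]_3) : leb3 A = (box_measure^*)%mu (row3 @^-1` A).
Proof. by []. Qed.

Lemma outer3_unrow3 (B : set mR3) : measurable B ->
  leb3 (unrow3 @^-1` B) = box_measure B.
Proof.
move=> mB; rewrite outer3E -comp_preimage (_ : unrow3 \o row3 = id).
  exact: measurable_mu_extE.
by apply/funext => p /=; rewrite row3K.
Qed.

Lemma measurable_unrow3 : measurable_fun [set: R3L R] (unrow3 : R3L R -> mR3).
Proof.
move=> _ B mB; rewrite setTI.
suff : caratheodory_measurable leb_outer3 (unrow3 @^-1` B) by [].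
move=> X.
have := @caratheodory_measurable_mu_ext _ R _ box_measure B mB (row3 @^-1` X).
rewrite (_ : row3 @^-1` X `&` B = row3 @^-1` (X `&` unrow3 @^-1` B)).
  rewrite (_ : row3 @^-1` X `&` ~` B = row3 @^-1` (X `&` ~` (unrow3 @^-1` B)))//.
  by apply/seteqP; split => p /=; rewrite row3K.
by apply/seteqP; split => p /=; rewrite row3K.
Qed.

Definition box (a b : 'rV[R]_3) : set 'rV[R]_3 :=
  [set x | forall i, a 0 i < x 0 i <= b 0 i].

Definition boxes : set (set 'rV[R]_3) := [set B | exists a b, B = box a b].

Lemma boxI (a b c d : 'rV[R]_3) : box a b `&` box c d =
  box (\row_i Num.max (a 0 i) (c 0 i)) (\row_i Num.min (b 0 i) (d 0 i)).
Proof.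
apply/seteqP; split => [x [ab cd] i|x H].
  have /andP[a1 b1] := ab i; have /andP[c1 d1] := cd i.
  by rewrite !mxE gt_max le_min a1 b1 c1 d1.
by split=> i; have := H i; rewrite !mxE gt_max le_min =>
  /andP[/andP[a1 c1] /andP[b1 d1]]; apply/andP.
Qed.

Lemma setI_box : setI_closed boxes.
Proof. by move=> _ _ [a [b ->]] [c [d ->]]; rewrite boxI; do 2 eexists. Qed.

Lemma boxE (a b : 'rV[R]_3) : box a b =
  unrow3 @^-1` ((`]a 0 0, b 0 0] `*` `]a 0 1, b 0 1]) `*` `]a 0 2, b 0 2]).
Proof.
apply/seteqP; split => [x H|x [[/= H0 H1] H2]].
  by split; [split|]; rewrite /= in_itv /= H.
by apply: forall_ord3; [move: H0|move: H1|move: H2]; rewrite in_itv.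
Qed.

Lemma measurable_box (a b : 'rV[R]_3) : measurable (box a b : set (R3L R)).
Proof.
rewrite boxE -[X in measurable X]setTI; apply: measurable_unrow3 => //.
by apply: measurableX => //; exact: measurableX.
Qed.

Lemma leb3_box_lty (a b : 'rV[R]_3) : (leb3 (box a b) < +oo)%E.
Proof.
rewrite boxE outer3_unrow3; last by apply: measurableX => //; exact: measurableX.
rewrite /box_measure product_measure1E//; last exact: measurableX.
rewrite /=; rewrite [X in (X * _)%E](@product_measure1E _ _ _ _ R lebesgue_measure lebesgue_measure)//=.
have L (x y : R) : (lebesgue_measure `]x, y] < +oo)%E.
  by rewrite lebesgue_measure_itv/=; case: ifP => // _; rewrite ltry.
have M (x y : \bar R) : (0 <= x -> x < +oo -> y < +oo -> x * y < +oo)%E.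
  by move=> x0 xoo yoo; rewrite lte_mul_pinfty// ge0_fin_numE.
by apply: (M) => //; [exact: mule_ge0|exact: M].
Qed.

Lemma measurable_unrow3_boxes :
  measurable_fun [set: g_sigma_algebraType boxes]
    (unrow3 : g_sigma_algebraType boxes -> mR3).
Proof.
have mc i : measurable_fun [set: g_sigma_algebraType boxes]
    ((fun x => x 0 i) : g_sigma_algebraType boxes -> mR).
  apply: (measurability _ (RGenOInfty.measurableE R)) => //.
  move=> _ [_ [r ->] <-]; rewrite setTI.
  rewrite (_ : _ @^-1` _ = \bigcup_n box
     (\row_j if j == i then r else - n%:R) (const_mx n%:R)).
    by apply: bigcupT_measurable => n; apply: sub_sigma_algebra; do 2 eexists.
  apply/seteqP; split => [x /=|x [n _ /(_ i)]].
    rewrite in_itv /= andbT => rx.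
    pose n := (\max_(j < 3) Num.bound `|x ord0 j|)%N.
    exists n => // j; rewrite !mxE.
    have xn : `|x 0 j| < n%:R.
      apply: (lt_le_trans (archi_boundP (normr_ge0 _))).
      by rewrite ler_nat; exact: leq_bigmax.
    have /ltr_normlP[xn1 xn2] := xn.
    by rewrite (ltW xn2) andbT; case: eqVneq => [->//|_]; rewrite ltrNl.
  by rewrite !mxE eqxx /= in_itv /= andbT => /andP[].
have mp : measurable_fun [set: g_sigma_algebraType boxes]
    (fun x : g_sigma_algebraType boxes => (x 0 0, x 0 1) : mR * mR).
  by apply: measurable_fun_pair; exact: mc.
by apply: (measurable_fun_pair mp); exact: mc.
Qed.

End LebesgueR3.

(** * Borel hulls and functions with vanishing integrals over boxes *)

Section BorelR3.
Context {R : realType}.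
Local Notation mR := (measurableTypeR R).
Local Notation mR3 := (mR * mR * mR)%type.
Local Notation borel3 := (g_sigma_algebraType (@boxes R)).

Definition cbox (a b : 'rV[R]_3) : set 'rV[R]_3 :=
  [set x | forall i, a 0 i <= x 0 i <= b 0 i].

(** Rational corners make the index type countable, so the exceptional null sets of all the boxes
    can be united. *)
Definition rat_box (p : 'rV[rat]_3 * 'rV[rat]_3 * nat) : set 'rV[R]_3 :=
  box (map_mx ratr p.1.1) (map_mx ratr p.1.2).

Definition rat_cbox (p : 'rV[rat]_3 * 'rV[rat]_3 * nat) : set 'rV[R]_3 :=
  cbox (map_mx ratr p.1.1) (map_mx ratr p.1.2 + const_mx p.2.+1%:R^-1).

(* The margin in [rat_cbox] leaves room for test functions approximating the
   indicator of [rat_box]. *)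
Lemma open_bigcup_box (U : set 'rV[R]_3) : open U ->
  U = \bigcup_(p in [set p | rat_cbox p `<=` U]) rat_box p.
Proof.
move=> oU; apply/seteqP; split => [x Ux|x [p /= pU H]]; last first.
  apply: pU => i; have /andP[/ltW -> le] := H i.
  by rewrite !mxE ler_wpDr//; move: le; rewrite !mxE.
have /nbhs_ballP[e /= e0 eU] : nbhs x U by exact: open_nbhs_nbhs.
have /choice[p Hp] (i : 'I_3) : exists q : rat, x 0 i - e < ratr q < x 0 i.
  have xe : x 0 i - e < x 0 i by rewrite ltrBlDr ltrDl.
  by have [q] := rat_in_itvoo xe; rewrite in_itv /=; exists q.
have /choice[q Hq] (i : 'I_3) : exists q : rat, x 0 i < ratr q < x 0 i + e / 2.
  have ex : x 0 i < x 0 i + e / 2 by rewrite ltrDl divr_gt0.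
  by have [r] := rat_in_itvoo ex; rewrite in_itv /=; exists r.
have [n ne] : exists n : nat, n.+1%:R^-1 < e / 2.
  have e20 : 0 < e / 2 by rewrite divr_gt0.
  have [n _ /(_ n (leqnn n))] := near_infty_natSinv_lt (PosNum e20).
  by exists n.
exists (\row_i p i, \row_i q i, n).
- move=> y H; apply: eU; split=> // i j; rewrite ord1.
  have := H j; have := Hp j; have := Hq j; rewrite !mxE /ball /= ltr_distl; move: ne.
  move: (n.+1%:R^-1 : R) => d {}ne /andP[? ?] /andP[? ?] /andP[? ?].
  by apply/andP; split; lra.
by move=> i; have := Hp i; have := Hq i; rewrite !mxE => /andP[/ltW -> _] /andP[_ ->].
Qed.

Lemma open_borel3 (U : set 'rV[R]_3) : open U -> measurable (U : set borel3).
Proof.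
move=> oU; rewrite (open_bigcup_box oU) bigcup_mkcond.
apply: countable_bigcupT_measurable => // p; case: ifP => // _.
by apply: sub_sigma_algebra; do 2 eexists.
Qed.

Lemma continuous_borel3 (f : 'rV[R]_3 -> R) : continuous f ->
  measurable_fun [set: borel3] (f : borel3 -> R).
Proof.
move=> /continuousP cf; apply: (measurability _ (RGenOpens.measurableE R)) => //.
by move=> _ [_ [a [b ->] <-]]; rewrite setTI; apply: open_borel3; exact/cf/interval_open.
Qed.

Lemma measurable_id_borel3 : measurable_fun [set: R3L R] (id : R3L R -> borel3).
Proof.
move=> _ B mB; rewrite setTI preimage_id.
suff : <<s boxes >> `<=` [set A | measurable (A : set (R3L R))] by exact.
apply: smallest_sub; last by move=> _ [a [b ->]]; exact: measurable_box.
split; first exact: measurable0.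
  by move=> A mA; rewrite setTD; exact: measurableC.
by move=> F mF; exact: bigcupT_measurable.
Qed.

Lemma measurable_row3 : measurable_fun [set: mR3] (row3 : mR3 -> borel3).
Proof.
apply: (@measurability _ _ _ borel3 _ _ boxes) => // _ [_ [a [b ->]] <-]; rewrite setTI boxE.
rewrite -comp_preimage (_ : unrow3 \o row3 = id); last by apply/funext => x /=; rewrite row3K.
by apply: measurableX => //; exact: measurableX.
Qed.

Lemma open_lmeasurable (U : set 'rV[R]_3) : open U -> lmeasurable U.
Proof.
by move=> oU; rewrite /lmeasurable -[U]setTI; apply: measurable_id_borel3 => //; exact: open_borel3.
Qed.

Lemma continuous_lmeasurable_fun (A : set 'rV[R]_3) (f : 'rV[R]_3 -> R) :
  continuous f -> lmeasurable_fun A f.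
Proof.
move=> /continuous_borel3 mf; apply: measurable_funTS.
exact: (measurableT_comp mf measurable_id_borel3).
Qed.

(** The boxes generate only the Borel sets; a hull carries statements about integrals from these to
    Lebesgue sets, up to a null set. *)
Lemma leb3_hull (E : set 'rV[R]_3) : (leb3 E < +oo)%E ->
  exists B : set borel3, [/\ measurable B, E `<=` B & leb3 B = leb3 E].
Proof.
rewrite outer3E => /mu_ext_hull[B [mB EB BE]].
exists (unrow3 @^-1` B); split.
- by rewrite -[X in measurable X]setTI; exact: measurable_unrow3_boxes.
- by move=> x Ex; apply: EB; rewrite /= unrow3K.
- by rewrite outer3_unrow3.
Qed.

(** The pi-lambda argument extends the vanishing from boxes to Borel sets. A Lebesgue set [E] inside
    the box is its Borel hull minus a null set, so all integrals of [v] vanish, and hence [v] does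
    almost everywhere. *)
Lemma box_integral_ae_eq0 (a b : 'rV[R]_3) (v : 'rV[R]_3 -> R) :
  leb3.-integrable (box a b) (EFin \o v) ->
  (forall c d, (\int[leb3]_(x in box a b `&` box c d) (v x)%:E = 0)%E) ->
  {ae leb3, forall x, box a b x -> v x = 0}.
Proof.
move=> vi v0; set Q := box a b.
have mQ : measurable (Q : set (R3L R)) by exact: measurable_box.
have B0 : forall B : set borel3, measurable B -> (\int[leb3]_(x in Q `&` B) (v x)%:E = 0)%E.
  apply: (@integral_pi_system_eq0 _ (R3L R) _ borel3 R leb3 id boxes Q v
    measurable_id_borel3 erefl (@setI_box R) mQ vi).
  - by rewrite -[Q in LHS]setIid v0.
  - by move=> _ [c [d ->]]; exact: v0.
have : ae_eq leb3 (Q : set (R3L R)) (EFin \o v) (cst 0%E).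
  apply: (integral_ae_eq mQ vi) => // E EQ mE.
  rewrite integral_cst// mul0e.
  have Eoo : (leb3 E < +oo)%E by apply: le_lt_trans (leb3_box_lty a b); apply: le_measure; rewrite ?inE.
  have [B [mB EB BE]] := leb3_hull Eoo.
  have mB' : measurable (B : set (R3L R)).
    by rewrite -[X in measurable X]setTI -[X in _ `&` X]preimage_id; exact: measurable_id_borel3.
  have Boo : (leb3 B < +oo)%E by rewrite BE.
  have N0 : leb3 (B `\` E) = 0%E.
    have -> : leb3 (B `\` E) = (leb3 B - leb3 (B `&` E))%E by exact: measureD.
    by rewrite setIidr// BE subee// ge0_fin_numE.
  have EE : (Q `&` B) `\` (B `\` E) = E.
    apply/seteqP; split => [x [[_ Bx] nBE]|x Ex].
      by apply: contrapT => nE; apply: nBE.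
    by split; [split; [exact: EQ|exact: EB]|move=> []].
  rewrite -[in LHS]EE -(B0 B mB) [RHS](negligible_integral _ _ _ N0)//.
  - exact: measurableD.
  - exact: measurableI.
  - by apply: (integrableS mQ) => //; exact: measurableI.
by apply: filterS => x /[apply] /= -[].
Qed.

End BorelR3.

(** * Smooth bump functions *)

Section FlatExponential.
Context {R : realType}.

(* The family [t^-k * exp (- 1/t)], extended by 0 to [t <= 0], is stable under
   differentiation up to linear combinations. *)
Definition flat_exp (k : nat) (t : R) : R :=
  if 0 < t then t^-1 ^+ k * expR (- t^-1) else 0.

Lemma flat_exp_ge0 k t : 0 <= flat_exp k t.
Proof.
rewrite /flat_exp; case: ifPn => // t0.
by rewrite mulr_ge0// ?expR_ge0// exprn_ge0// invr_ge0 ltW.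
Qed.

Lemma flat_exp0_le1 t : flat_exp 0 t <= 1.
Proof.
rewrite /flat_exp; case: ifPn => // t0.
by rewrite expr0 mul1r expR_le1 oppr_le0 invr_ge0 ltW.
Qed.

(** The exponential dominates the term of degree k+2 of its series at 1/t. Two spare powers of [t]
    are kept so that the difference quotient at 0 tends to 0. *)
Lemma flat_exp_sqr k t : flat_exp k t <= (k.+2)`!%:R * t ^+ 2.
Proof.
rewrite /flat_exp; case: ifPn => t0; last by rewrite mulr_ge0// sqr_ge0.
have y0 : 0 < t^-1 by rewrite invr_gt0.
rewrite expRN -[t in leRHS]invrK; move: t^-1 y0 => y y0.
rewrite exprVn ler_pdivrMr ?expR_gt0// mulrAC ler_pdivlMr ?exprn_gt0//.
rewrite -exprD addn2.
have f0 : 0 < (k.+2)`!%:R :> R by rewrite ltr0n fact_gt0.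
rewrite mulrC -ler_pdivrMr//.
by apply: le_trans (expR_ge1Dxn k.+1 (ltW y0)); rewrite lerDr.
Qed.

Lemma is_derive_cvg (V : normedModType R) (f : V -> R) (x v : V) (l : R) :
  h^-1 *: (f (h *: v + x) - f x) @[h --> 0^'] --> l -> is_derive x v f l.
Proof.
move=> H; split; first by apply/cvg_ex; exists l.
exact: cvg_lim H.
Qed.

Lemma is_derive_flat_exp (k : nat) (t : R) :
  is_derive t 1 (flat_exp k) (flat_exp k.+2 t - k%:R * flat_exp k.+1 t).
Proof.
have [t0|t0|->] := ltgtP t 0.
- rewrite {2 3}/flat_exp (lt_gtF t0) mulr0 subr0.
  apply: (near_eq_is_derive (f := cst 0)) => //.
  near=> s; rewrite /flat_exp ltNge ltW//; near: s.
  exact: lt_nbhsl.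
- rewrite {2 3}/flat_exp t0.
  pose u := (fun s : R => s^-1).
  have du : is_derive t 1 u (- t^-1 ^+ 2).
    apply: is_derive_eq; first by apply: is_deriveV; rewrite gt_eqF.
    by rewrite /GRing.scale /= mulr1 exprVn.
  have d1 : is_derive t 1 (u ^+ k * (expR \o (- u))) (t^-1 ^+ k.+2 * expR (- t^-1) -
      k%:R * (t^-1 ^+ k.+1 * expR (- t^-1))).
    apply: is_derive_eq; rewrite /GRing.scale /= /u opprK.
    rewrite exprfctE /= opprfctE.
    by case: (k) => [|j] /=; rewrite ?mul0r ?expr0 ?exprS; ring.
  apply: near_eq_is_derive d1.
  near=> s; rewrite /flat_exp ifT; last by near: s; exact: lt_nbhsr.
  by rewrite mulrfctE exprfctE.
(* At the origin the candidate derivative is 0, and by [flat_exp_sqr] the difference quotient is at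
   most a constant times the increment. *)
rewrite {2 3}/flat_exp ltxx mulr0 subr0.
apply: is_derive_cvg.
set C : R := (k.+2)`!%:R.
have C0 : 0 <= C by [].
apply/cvgr0Pnorm_le => e e0; near=> h.
have h0 : h != 0 by near: h; exact: nbhs_dnbhs_neq.
rewrite /flat_exp ltxx subr0 -/(flat_exp k _) addr0 /GRing.scale /= mulr1 normrM normfV.
rewrite mulrC ler_pdivrMr ?normr_gt0// ger0_norm ?flat_exp_ge0//.
apply: (le_trans (flat_exp_sqr _ _)); rewrite -/C -(real_normK (num_real h)) expr2 mulrA.
rewrite ler_wpM2r//.
have h1 : `|h| <= e / (C + 1).
  by near: h; apply: dnbhs0_le; rewrite divr_gt0// ltr_wpDl.
apply: (le_trans (ler_wpM2l C0 h1)); rewrite mulrCA ger_pMr// ler_pdivrMr ?ltr_wpDl// mul1r lerDl//.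
Unshelve. all: by end_near. Qed.

Lemma continuous_flat_exp k : continuous (flat_exp k).
Proof.
move=> t; apply/differentiable_continuous/derivable1_diffP.
by have [] := is_derive_flat_exp k t.
Qed.

End FlatExponential.

Section TestFunctions.
Context {R : realType}.

(** A syntactic algebra closed under partial derivatives. Continuity and differentiability of its
    members then give smoothness of every order without any formula for iterated derivatives. *)
Inductive flat_fun : ('rV[R]_3 -> R) -> Prop :=
| flat_cst c : flat_fun (fun=> c)
| flat_coord k i (a b : R) : flat_fun (fun x => flat_exp k (a * x 0 i + b))
| flat_add f g : flat_fun f -> flat_fun g -> flat_fun (fun x => f x + g x)
| flat_mul f g : flat_fun f -> flat_fun g -> flat_fun (fun x => f x * g x).

Lemma flat_fun_continuous f : flat_fun f -> continuous f.
Proof.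
elim=> {f} [c|k i a b|f g _ cf _ cg|f g _ cf _ cg] x.
- exact: cst_continuous.
- apply: (@continuous_comp _ _ _ (fun x : 'rV[R]_3 => a * x 0 i + b) (flat_exp k)).
    apply: continuousD; last exact: cst_continuous.
    by apply: continuousM; [exact: cst_continuous|exact: coord_continuous].
  exact: continuous_flat_exp.
- exact: continuousD (cf x) (cg x).
- exact: continuousM (cf x) (cg x).
Qed.

Lemma is_derive_coord (G : R -> R) (i j : 'I_3) (x : 'rV[R]_3) (l : R) :
  is_derive (x 0 i) 1 G l ->
  is_derive x (delta_mx 0 j) (fun y : 'rV[R]_3 => G (y 0 i)) ((i == j)%:R * l).
Proof.
move=> [dG Gl]; apply: is_derive_cvg.
have C : h^-1 *: (G (h *: 1 + x 0 i) - G (x 0 i)) @[h --> 0^'] --> l.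
  by rewrite -Gl; exact: dG.
have [ij|ij] := eqVneq i j.
  rewrite mul1r; apply: cvg_trans C; apply: near_eq_cvg; apply: nearW => h.
  by rewrite !mxE ij !eqxx.
rewrite mul0r; apply: cvg_near_cst; apply: nearW => h.
by rewrite !mxE (negbTE ij) andbF mulr0 add0r subrr scaler0.
Qed.

Lemma flat_fun_derive f i : flat_fun f ->
  exists2 f', flat_fun f' & forall x, is_derive x (delta_mx 0 i) f (f' x).
Proof.
elim=> {f} [c|k j a b|f g _ [f' ff' df] _ [g' fg' dg]|f g ff [f' ff' df] fg [g' fg' dg]].
- exists (fun=> 0); first exact: flat_cst.
  by move=> x; exact: is_derive_cst.
- exists (fun x => ((j == i)%:R * a) * (flat_exp k.+2 (a * x 0 j + b) +
      (- k%:R) * flat_exp k.+1 (a * x 0 j + b))).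
    apply: flat_mul; first exact: flat_cst.
    apply: flat_add; first exact: flat_coord.
    by apply: flat_mul; [exact: flat_cst|exact: flat_coord].
  move=> x; rewrite -mulrA.
  apply: (@is_derive_coord (fun t => flat_exp k (a * t + b))).
  pose u (t : R) := a * t + b.
  have du : is_derive (x 0 j) 1 u a.
    by apply: is_derive_eq; rewrite /GRing.scale /= mulr1 addr0.
  have := is_derive1_comp (is_derive_flat_exp k (u (x 0 j))) du.
  by rewrite mulrC mulNr.
- exists (fun x => f' x + g' x); first exact: flat_add.
  by move=> x; exact: is_deriveD.
- exists (fun x => f x * g' x + g x * f' x).
    by apply: flat_add; exact: flat_mul.
  by move=> x; exact: is_deriveM.
Qed.

Lemma flat_fun_smooth O f : flat_fun f -> smooth_on O f.
Proof.
move=> ff l x _.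
have fl : flat_fun (foldr partial f l).
  elim: l => //= i l; move: (foldr _ _ _) => g /(flat_fun_derive i)[g' fg' dg].
  rewrite (_ : partial i g = g')//; apply/funext => y.
  by rewrite /partial; have [_ ->] := dg y.
split; first exact: flat_fun_continuous.
by move=> i; have [g' _ /(_ x)[]] := flat_fun_derive i fl.
Qed.

(** The first factor is positive exactly for [a 0 i < x 0 i], the second exactly for
    [x 0 i < b 0 i + 1/(n+1)]. The inner shift by 1 keeps the right face, so that the pointwise
    limit is the indicator of the half-open [box a b]; the outer factors n+1 send the arguments to
    infinity there, where [flat_exp 0] tends to 1. *)
Definition bump (a b : 'rV[R]_3) (n : nat) (x : 'rV[R]_3) : R :=
  \prod_i (flat_exp 0 (n.+1%:R * (x 0 i - a 0 i)) *
           flat_exp 0 (n.+1%:R * (n.+1%:R * (b 0 i - x 0 i) + 1))).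

Lemma flat_fun_prod n (F : 'I_n -> 'rV[R]_3 -> R) :
  (forall i, flat_fun (F i)) -> flat_fun (fun x => \prod_i F i x).
Proof.
elim: n F => [|n IH] F FF.
  by under eq_fun do rewrite big_ord0; exact: flat_cst.
under eq_fun do rewrite big_ord_recl.
by apply: flat_mul => //; exact: IH.
Qed.

Lemma flat_fun_bump a b n : flat_fun (bump a b n).
Proof.
apply: flat_fun_prod => i.
rewrite (_ : (fun _ => _) = (fun x : 'rV[R]_3 =>
  flat_exp 0 (n.+1%:R * x 0 i + (- n.+1%:R * a 0 i)) *
  flat_exp 0 (- (n.+1%:R ^+ 2) * x 0 i + (n.+1%:R ^+ 2 * b 0 i + n.+1%:R)))).
  by apply: flat_mul; exact: flat_coord.
by apply/funext => x; congr (flat_exp _ _ * flat_exp _ _); ring.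
Qed.

Lemma bump_ge0 a b n x : 0 <= bump a b n x.
Proof. by apply: prodr_ge0 => i _; rewrite mulr_ge0// flat_exp_ge0. Qed.

Lemma bump_le1 a b n x : bump a b n x <= 1.
Proof.
apply: prodr_ile1 => i _.
by rewrite mulr_ge0 ?flat_exp_ge0//= mulr_ile1 ?flat_exp_ge0 ?flat_exp0_le1.
Qed.

Lemma bump_support a b n x : bump a b n x != 0 ->
  cbox a (b + const_mx n.+1%:R^-1) x.
Proof.
move=> /prodf_neq0 H i; have := H i isT.
rewrite mulf_eq0 negb_or /flat_exp => /andP[].
case: ifPn => [|_]; last by rewrite eqxx.
rewrite pmulr_rgt0 ?ltr0n// subr_gt0 => /ltW -> _.
case: ifPn => [|_]; last by rewrite eqxx.
rewrite pmulr_rgt0 ?ltr0n// !mxE -(ltr_pM2l (x := n.+1%:R^-1)) ?invr_gt0 ?ltr0n//.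
rewrite mulr0 mulrDr mulKf ?pnatr_eq0// mulr1.
move: (n.+1%:R^-1 : R) => d H1 _ /=; lra.
Qed.

Lemma closed_cbox a b : closed (@cbox R a b).
Proof.
rewrite (_ : cbox a b = \bigcap_(i in [set: 'I_3]) ((fun x : 'rV[R]_3 => x 0 i) @^-1` `[a 0 i, b 0 i])).
  apply: closed_bigI => i _; apply: closed_comp; last exact: interval_closed.
  by move=> x _; exact: coord_continuous.
by apply/seteqP; split => [x H i _|x H i]; [rewrite /= in_itv /= H|have := H i I; rewrite /= in_itv].
Qed.

Lemma compact_cbox a b : compact (@cbox R a b).
Proof.
have := @rV_compact R 3 (fun i => `[a 0 i, b 0 i]%classic) (fun i => @segment_compact _ _ _).
congr compact; apply/seteqP; split => x H i; have := H i; by rewrite /= in_itv.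
Qed.

Lemma test_fun_supp (O K : set 'rV[R]_3) f : smooth_on setT f -> closed K -> compact K ->
  K `<=` O -> (forall x, f x != 0 -> K x) -> test_fun O f.
Proof.
move=> sf clK cK KO fK.
have cl : closure [set x | f x != 0] `<=` K.
  by rewrite [X in _ `<=` X](closure_id K).1//; exact: closureS.
split => //; last exact: subset_trans KO.
by apply: subclosed_compact cK cl; exact: closed_closure.
Qed.

Lemma test_fun_bump a b n (O : set 'rV[R]_3) :
  cbox a (b + const_mx n.+1%:R^-1) `<=` O -> test_fun O (bump a b n).
Proof.
move=> H; apply: test_fun_supp H _.
- by apply: flat_fun_smooth; exact: flat_fun_bump.
- exact: closed_cbox.
- exact: compact_cbox.
- exact: bump_support.
Qed.

Lemma flat_exp0_cvg (u : R^nat) : u @ \oo --> +oo -> flat_exp 0 (u n) @[n --> \oo] --> (1 : R).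
Proof.
move=> uoo.
have u0 : \forall n \near \oo, 0 < u n by move/cvgryPgt : (uoo); exact.
have H : expR (- (u n)^-1) @[n --> \oo] --> expR (- 0 : R).
  apply: continuous_cvg; first exact: continuous_expR.
  by apply: cvgN; exact/gtr0_cvgV0.
rewrite oppr0 expR0 in H; apply: cvg_trans H; apply: near_eq_cvg.
near=> n; rewrite /flat_exp ifT ?expr0 ?mul1r//.
by near: n.
Unshelve. all: by end_near. Qed.

Lemma natmul_cvgy (u : R^nat) (c : R) : 0 < c -> (forall n, c * n%:R <= u n) ->
  u @ \oo --> +oo.
Proof.
move=> c0 H; apply/cvgryPge => A; near=> n; apply: le_trans (H n).
by rewrite -ler_pdivrMl//; near: n; exact: nbhs_infty_ger.
Unshelve. all: by end_near. Qed.

Lemma bump_cvg a b x : bump a b n x @[n --> \oo] --> (\1_(box a b) x : R).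
Proof.
have [xB|nxB] := pselect (box a b x); last first.
  rewrite indicE memNset//.
  move: nxB => /existsNP[i /negP]; rewrite negb_and -!leNgt => H.
  apply: cvg_near_cst; near=> n.
  rewrite /bump (bigD1 i)//= /flat_exp.
  case/orP: H => H.
    by rewrite ifF ?mul0r// ltNge pmulr_rle0 ?ltr0n// subr_le0 H.
  rewrite [X in _ * X * _]ifF ?mulr0 ?mul0r//.
  rewrite ltNge pmulr_rle0 ?ltr0n//.
  have bx : 0 < x 0 i - b 0 i by rewrite subr_gt0 ltNge.
  have : (x 0 i - b 0 i)^-1 <= n.+1%:R.
    by apply: (@le_trans _ _ n%:R); [near: n; exact: nbhs_infty_ger|rewrite ler_nat].
  rewrite -(ler_pM2r bx) mulVf ?gt_eqF//; move: (n.+1%:R : R) => N H1.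
  by lra.
rewrite indicE mem_set//=.
rewrite (_ : 1%:R = \prod_(i < 3) (1 * 1 : R)); last by rewrite big1// => i _; rewrite mulr1.
apply: cvg_big => //.
  exact: mul_continuous.
move=> i _; have /andP[xa xb] := xB i.
apply: cvgM; apply: flat_exp0_cvg.
  apply: (@natmul_cvgy _ (x 0 i - a 0 i)); first by rewrite subr_gt0.
  by move=> n; rewrite mulrC; apply: ler_wpM2r; [rewrite subr_ge0 ltW|rewrite ler_nat].
apply: (@natmul_cvgy _ 1) => // n.
rewrite mul1r; apply: (@le_trans _ _ n.+1%:R); first by rewrite ler_nat.
by rewrite ler_peMr// lerDr mulr_ge0// subr_ge0.
Unshelve. all: by end_near. Qed.

End TestFunctions.

(** * The fundamental lemma of the calculus of variations *)

Section FundamentalLemma.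
Context {R : realType}.

Lemma normr_coord_le (x : 'rV[R]_3) (i : 'I_3) : `|x 0 i| <= `|x|.
Proof.
have -> : `|x| = mx_norm x by [].
by rewrite mx_normrE; apply/bigmax_geP; right => /=; exists (0, i).
Qed.

Lemma bounded_leb3_lty (A : set 'rV[R]_3) : bounded_set A -> lmeasurable A ->
  (leb3 A < +oo)%E.
Proof.
move=> [M [Mr HM]] mA.
have H x i : A x -> `|x 0 i| <= M + 1.
  move=> Ax; apply: le_trans (HM (M + 1) _ x Ax); last by rewrite ltrDl.
  exact: normr_coord_le.
apply: le_lt_trans (leb3_box_lty (const_mx (- (M + 2))) (const_mx (M + 2))).
apply: le_measure; rewrite ?inE//; first exact: measurable_box.
move=> x Ax i; rewrite !mxE; have := H x i Ax; rewrite ler_norml => /andP[? ?].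
by apply/andP; split; lra.
Qed.

Lemma ae_forall_countable d (T : measurableType d) (mu : {measure set T -> \bar R})
    (I : countType) (P : I -> T -> Prop) :
  (forall i, {ae mu, forall x, P i x}) -> {ae mu, forall x i, P i x}.
Proof.
move=> H; have := negligible_countable_bigcup H; apply: negligibleS => x /=.
by move/existsNP => [i nP]; exists i.
Qed.

(** Integrals of [v] against bumps converge, dominated by the absolute value of [v], to integrals
    over small boxes. Countably many rational boxes exhaust [Om], so it suffices to treat one of
    them. *)
Lemma fundamental_lemma (Om : set 'rV[R]_3) (v : 'rV[R]_3 -> R) : open Om ->
  leb3.-integrable Om (EFin \o v) ->
  (forall psi, test_fun Om psi -> ip Om v psi = 0) ->
  {ae leb3, forall x, Om x -> v x = 0}.
Proof.
move=> oO vi v0.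
have mO : measurable (Om : set (R3L R)) by exact: open_lmeasurable.
have mv : measurable_fun (Om : set (R3L R)) (v : R3L R -> R).
  by apply/measurable_EFinP; exact: measurable_int vi.
suff H p : {ae leb3, forall x, rat_cbox p `<=` Om -> rat_box p x -> v x = 0}.
  have := ae_forall_countable H; apply: filterS => x Hx.
  by rewrite [in X in X -> _](open_bigcup_box oO) => -[p /= pO /Hx]; apply.
have [pO|npO] := pselect (rat_cbox p `<=` Om); last by apply: aeW => x /npO.
suff : {ae leb3, forall x, rat_box p x -> v x = 0}.
  by apply: (@filterS _ _ (ae_filter_ringOfSetsType leb3)) => x + _.
set a := map_mx ratr p.1.1 : 'rV[R]_3; set b := map_mx ratr p.1.2 : 'rV[R]_3.
have bO : rat_box p `<=` Om.
  move=> x H; apply: pO => i; have /andP[/ltW -> le] := H i.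
  by rewrite !mxE ler_wpDr//; move: le; rewrite !mxE.
apply: box_integral_ae_eq0.
  by apply: integrableS vi => //; exact: measurable_box.
move=> c d; rewrite -/a -/b.
pose a' := \row_i Num.max (a 0 i) (c 0 i); pose b' := \row_i Num.min (b 0 i) (d 0 i).
rewrite boxI -/a' -/b'.
have b'O : box a' b' `<=` Om.
  move=> x H; apply: bO => i; have := H i; rewrite !mxE gt_max le_min.
  by move=> /andP[/andP[? _] /andP[? _]]; apply/andP.
have mfn n : measurable_fun (Om : set (R3L R)) (fun x => (v x * bump a' b' n x)%:E).
  apply/measurable_EFinP/measurable_funM => //.
  by apply: continuous_lmeasurable_fun; exact/flat_fun_continuous/flat_fun_bump.
have mf : measurable_fun (Om : set (R3L R)) (fun x => (v x * \1_(box a' b') x)%:E).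
  apply/measurable_EFinP/measurable_funM => //.
  by apply: measurable_indic; exact: measurable_box.
have fnf : {ae leb3, forall x, Om x ->
    (v x * bump a' b' n x)%:E @[n --> \oo] --> (v x * \1_(box a' b') x)%:E}.
  apply: aeW => x _; apply: cvg_EFin; first by apply: nearW.
  by apply: cvgM; [exact: cvg_cst|exact: bump_cvg].
have fnv : {ae leb3, forall x n, Om x -> (`|(v x * bump a' b' n x)%:E| <= `|v x|%:E)%E}.
  apply: aeW => x n _; rewrite abse_EFin.
  by rewrite lee_fin normrM ler_piMr// ger0_norm ?bump_ge0 ?bump_le1.
have vi' := integrable_norm vi.
have [_ _ D] := dominated_convergence mO mfn mf fnf vi' fnv.
have D0 : (\int[leb3]_(x in Om) (v x * \1_(box a' b') x)%:E = 0)%E.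
  rewrite -(cvg_lim _ D)//; apply: lim_near_cst => //; near=> n.
  (* The support of the bump stays inside [rat_cbox p] once n is at least [p.2], so the integrals
     vanish only eventually. *)
  have T : test_fun Om (bump a' b' n).
    apply: test_fun_bump => x H; apply: pO => i; have := H i; rewrite !mxE.
    rewrite ge_max => /andP[/andP[-> _]]; rewrite -lerBlDr le_min => /andP[+ _].
    rewrite lerBlDr => /le_trans; apply; rewrite lerD2l lef_pV2 ?posrE ?ltr0n// ler_nat ltnS.
    by near: n; exact: nbhs_infty_ge.
  have vb : leb3.-integrable Om (EFin \o (fun x => v x * bump a' b' n x)).
    apply: (le_integrable mO (mfn n) _ vi) => x _.
    by rewrite lee_fin normrM ler_piMr// ger0_norm ?bump_ge0 ?bump_le1.
  have := v0 _ T; rewrite /ip /Rintegral => V; rewrite -[LHS]fineK ?V//.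
  exact: integrable_fin_num vb.
rewrite -D0 -[in LHS](setIidr b'O) [LHS]integral_mkcondr.
apply: eq_integral => x _; rewrite patchE indicE.
by case: ifP => _; rewrite ?mulr1 ?mulr0.
Unshelve. all: by end_near. Qed.

End FundamentalLemma.

(** * Integration by parts *)

(** Serves to replace the Caratheodory measure [leb3] by the product measure, for which Fubini is
    available. *)
Lemma integral_transfer d d' (X : measurableType d) (Y : measurableType d')
    (R : realType) (m : {measure set X -> \bar R}) (n : {measure set Y -> \bar R})
    (phi : X -> Y) : measurable_fun setT phi ->
  (forall A, measurable A -> m (phi @^-1` A) = n A) ->
  forall f : Y -> \bar R, measurable_fun setT f -> m.-integrable setT (f \o phi) ->
  n.-integrable setT f /\ (\int[m]_x (f \o phi) x = \int[n]_y f y)%E.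
Proof.
move=> mphi mn f mf fi.
pose Phi : {mfun X >-> Y} := mfun_Sub (mem_set mphi).
have fi' : m.-integrable (Phi @^-1` setT) (f \o Phi) by [].
have M A : measurable A -> A `<=` setT -> pushforward m Phi A = n A.
  by move=> mA _; exact: mn.
split.
  apply/integrableP; split => //; rewrite -(eq_measure_integral _ M).
  by have /integrableP[] := integrable_pushforward (@measurable_funPT _ _ _ _ Phi) mf fi' measurableT.
rewrite -(eq_measure_integral _ M).
by rewrite (integral_pushforward (@measurable_funPT _ _ _ _ Phi) mf fi' measurableT).
Qed.

Section IteratedIntegral.
Context d1 d2 (T1 : measurableType d1) (T2 : measurableType d2) {R : realType}.
Variables (m1 : {sigma_finite_measure set T1 -> \bar R})
  (m2 : {sigma_finite_measure set T2 -> \bar R}).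

Lemma sigma_finite_product : sigma_finite setT (m1 \x m2)%E.
Proof.
have /sigma_finiteP[F [FT ndF Foo]] := sigma_finiteT m1.
have /sigma_finiteP[G [GT ndG Goo]] := sigma_finiteT m2.
exists (fun n => F n `*` G n).
  apply/seteqP; split => // -[x y] _.
  have [i _ Fx] : (\bigcup_i F i) x by rewrite -FT.
  have [j _ Gy] : (\bigcup_i G i) y by rewrite -GT.
  exists (maxn i j) => //; split.
    by have /subsetPset := ndF _ _ (leq_maxl i j); apply.
  by have /subsetPset := ndG _ _ (leq_maxr i j); apply.
move=> n; have [mF Fn] := Foo n; have [mG Gn] := Goo n.
by split; [exact: measurableX|rewrite product_measure1E// lte_mul_pinfty// ge0_fin_numE].
Qed.

(* An alias: the library's sigma-finite structure on [m1 \x m2] is keyed to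
   finite measures. *)
Definition sfprod : set (T1 * T2) -> \bar R := (m1 \x m2)%E.

HB.instance Definition _ := Measure.copy sfprod (m1 \x m2)%E.

HB.instance Definition _ := Measure_isSigmaFinite.Build _ _ _ sfprod
  sigma_finite_product.

(** Fubini makes the variable with vanishing integral the innermost one. Integrability on the triple
    product would give integrable slices for almost every [z] only, hence the separate hypothesis on
    slices. *)
Lemma iterated_integral_eq0 d3 (T3 : measurableType d3)
    (m3 : {sigma_finite_measure set T3 -> \bar R}) (f : T1 * T2 * T3 -> \bar R) :
  (sfprod \x m3)%E.-integrable setT f ->
  (forall z, (m1 \x m2)%E.-integrable setT (fun p => f (p, z))) ->
  [\/ forall y z, (\int[m1]_x f (x, y, z) = 0)%E,
      forall x z, (\int[m2]_y f (x, y, z) = 0)%E |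
      forall p, (\int[m3]_z f (p, z) = 0)%E] ->
  (\int[sfprod \x m3]_p f p = 0)%E.
Proof.
move=> fi fzi; case=> H.
- rewrite -(integral21_prod_meas1 fi); apply: integral0_eq => z _.
  rewrite /fubini_G -(integral21_prod_meas1 (fzi z)).
  by apply: integral0_eq => y _; exact: H.
- rewrite -(integral21_prod_meas1 fi); apply: integral0_eq => z _.
  rewrite /fubini_G -(integral12_prod_meas1 (fzi z)).
  by apply: integral0_eq => x _; exact: H.
- by rewrite -(integral12_prod_meas1 fi); apply: integral0_eq => p _; exact: H.
Qed.

End IteratedIntegral.

Section IntegrationByParts.
Context {R : realType}.
Local Notation mR := (measurableTypeR R).
Local Notation leb2 := (@lebesgue_measure R \x @lebesgue_measure R)%E.
Local Notation mR3 := (mR * mR * mR)%type.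
Local Notation e i := (delta_mx 0 i : 'rV[R]_3).

Definition supported_within (M : R) (f : 'rV[R]_3 -> R) :=
  forall (x : 'rV[R]_3) (i : 'I_3), M < `|x 0 i| -> f x = 0.

(** Normalising [y 0 i = 0] makes [t] the i-th coordinate of the moving point. The integral reduces
    to the segment from -N to N with [N > M], at whose ends [h] vanishes. *)
Lemma integral_line_partial (h : 'rV[R]_3 -> R) (i : 'I_3) (M : R) (y : 'rV[R]_3) :
  (forall x, derivable h x (e i)) -> continuous (partial i h) ->
  supported_within M h -> supported_within M (partial i h) -> y 0 i = 0 ->
  (\int[lebesgue_measure]_t (partial i h (t *: e i + y))%:E = 0)%E.
Proof.
move=> dh ch h0 p0 y0.
pose k t := h (t *: e i + y); pose dk t := partial i h (t *: e i + y).
have ti t : (t *: e i + y) 0 i = t by rewrite !mxE !eqxx y0 mulr1 addr0.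
have Dk (t : R) : is_derive t 1 k (dk t).
  apply: is_derive_cvg; have := dh (t *: e i + y); rewrite /derivable => D.
  rewrite /dk /partial /derive; apply: cvg_trans D; apply: near_eq_cvg.
  by apply: nearW => s; rewrite /k /= scalerDl addrA /GRing.scale /= mulr1.
have cdk : continuous dk.
  move=> t; apply: (@continuous_comp _ _ _ (fun t : R => t *: e i + y)); last exact: ch.
  apply: continuousD; last exact: cst_continuous.
  exact: scalel_continuous.
pose N := `|M| + 1.
have MN : M < N by rewrite (le_lt_trans (ler_norm _))// ltrDl.
have N0 : 0 < N by rewrite ltr_wpDl.
have out t : N <= `|t| -> k t = 0 /\ dk t = 0.
  by move=> Nt; split; [apply: (h0 _ i)|apply: (p0 _ i)]; rewrite ti (lt_le_trans MN).
have -> : (\int[lebesgue_measure]_t (dk t)%:E =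
    \int[lebesgue_measure]_(t in `[(- N)%R, N]) (dk t)%:E)%E.
  rewrite [RHS]integral_mkcond; apply: eq_integral => t _.
  rewrite patchE; case: ifPn => // /negP.
  rewrite inE /= in_itv /= -ler_norml => /negP; rewrite -ltNge => Nt.
  by have [_ ->] := out t (ltW Nt).
rewrite (@continuous_FTC2 _ dk k).
- have [-> _] := out N (ler_norm _).
  by have [|-> _] := out (- N); rewrite ?normrN ?ler_norm// subee.
- by rewrite gtrN.
- exact: continuous_subspaceT.
- have ck t : {for t, continuous k}.
    by apply/differentiable_continuous/derivable1_diffP; have [] := Dk t.
  split.
  + by move=> t _; have [] := Dk t.
  + exact: cvg_at_right_filter (ck _).
  + exact: cvg_at_left_filter (ck _).
- by move=> t _; rewrite derive1E; have [_] := Dk t.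
Qed.

Lemma bounded_support_integrable d (T : measurableType d) (mu : {measure set T -> \bar R})
    (f : T -> R) (C : R) (B : set T) : measurable_fun setT f ->
  (forall x, `|f x| <= C) -> measurable B -> (mu B < +oo)%E ->
  (forall x, ~ B x -> f x = 0) -> mu.-integrable setT (EFin \o f).
Proof.
move=> mf fC mB Boo f0.
have -> : EFin \o f = (EFin \o f) \_ B.
  apply/funext => x; rewrite patchE; case: ifPn => //= /negP.
  by rewrite inE => /f0 ->.
apply: (integrable_mkcond _ mB).1; apply: measurable_bounded_integrable => //.
  exact: measurable_funS mf.
by exists C; split; [exact: num_real|move=> D CD x _ /=; rewrite (le_trans (fC x)) ?ltW].
Qed.

(** The margin 1 pays for the left faces, which half-open boxes omit. *)
Lemma supported_within_box (M : R) (f : 'rV[R]_3 -> R) x : supported_within M f ->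
  ~ box (const_mx (- (`|M| + 1))) (const_mx (`|M| + 1)) x -> f x = 0.
Proof.
move=> fM /existsNP[i /negP H]; apply: (fM _ i); rewrite ltNge; apply: contra H.
have MM := ler_norm M.
by rewrite !mxE ler_norml => /andP[? ?]; apply/andP; split; lra.
Qed.

Lemma supported_within_bounded (M : R) (f : 'rV[R]_3 -> R) : continuous f ->
  supported_within M f -> exists C, forall x, `|f x| <= C.
Proof.
move=> cf fM; set a : 'rV[R]_3 := const_mx (- (`|M| + 1)); set b : 'rV[R]_3 := const_mx (`|M| + 1).
have : compact (f @` cbox a b).
  by apply: continuous_compact (@compact_cbox R a b); exact: continuous_subspaceT.
move=> /compact_bounded[C [_ HC]]; exists (`|C| + 1) => x.
have [xB|xB] := pselect (box a b x); last by rewrite (supported_within_box fM xB) normr0 addr_ge0.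
apply: HC; first by rewrite (le_lt_trans (ler_norm _))// ltrDl.
by exists x => // i; have /andP[/ltW -> ->] := xB i.
Qed.

(** Continuity makes [F] Borel, hence measurable for the product sigma-algebra. *)
Lemma integral_row3 (F : 'rV[R]_3 -> R) : continuous F ->
  leb3.-integrable setT (EFin \o F) ->
  (leb2 \x @lebesgue_measure R)%E.-integrable setT (fun p : mR3 => (F (row3 p))%:E) /\
  (\int[leb3]_x (F x)%:E = \int[leb2 \x @lebesgue_measure R]_p (F (row3 p))%:E)%E.
Proof.
move=> cF iF; set G := fun p : mR3 => (F (row3 p))%:E.
have mG : measurable_fun [set: mR3] G.
  by apply/measurable_EFinP; exact: (measurableT_comp (continuous_borel3 cF) measurable_row3).
have E : EFin \o F = G \o unrow3 by apply/funext => x; rewrite /G /= unrow3K.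
have iG : leb3.-integrable setT (G \o unrow3) by rewrite -E.
have := @integral_transfer _ _ (R3L R) mR3 R leb3 (leb2 \x @lebesgue_measure R)%E unrow3
  (@measurable_unrow3 R) (@outer3_unrow3 R) G mG iG.
by rewrite -E.
Qed.

Lemma integral_partial_eq0 (h : 'rV[R]_3 -> R) (i : 'I_3) (M : R) :
  (forall x, derivable h x (e i)) -> continuous (partial i h) ->
  supported_within M h -> supported_within M (partial i h) ->
  leb3.-integrable setT (EFin \o partial i h) /\
  (\int[leb3]_x (partial i h x)%:E = 0)%E.
Proof.
move=> dh ch h0 p0; set F := partial i h.
have [C HC] := supported_within_bounded ch p0.
have iF : leb3.-integrable setT (EFin \o F).
  apply: (@bounded_support_integrable _ (R3L R) leb3 F C
    (box (const_mx (- (`|M| + 1))) (const_mx (`|M| + 1))) _ HC) => [|||x].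
  - exact: continuous_lmeasurable_fun.
  - exact: measurable_box.
  - exact: leb3_box_lty.
  - exact: supported_within_box p0.
split => //.
have [iG ->] := integral_row3 ch iF.
have L (y : 'rV[R]_3) : y 0 i = 0 -> (\int[lebesgue_measure]_t (F (t *: e i + y))%:E = 0)%E.
  by move=> y0; exact: integral_line_partial h0 p0 y0.
have mG : measurable_fun [set: mR3] (fun p : mR3 => F (row3 p)).
  exact: (measurableT_comp (continuous_borel3 ch) measurable_row3).
pose I : set mR := [set` `](- (`|M| + 1)), `|M| + 1]].
have mI : measurable I by exact: measurable_itv.
have I_lty : (lebesgue_measure I < +oo)%E.
  by rewrite lebesgue_measure_itv/=; case: ifP => // _; rewrite ltry.
have II_lty : (leb2 (I `*` I) < +oo)%E.
  by rewrite product_measure1E// lte_mul_pinfty// ge0_fin_numE.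
have iS z : leb2.-integrable setT
    (fun p : mR * mR => (F (row3 (p, z)))%:E).
  apply: (@bounded_support_integrable _ (mR * mR)%type
    leb2 _ C (I `*` I)) => //.
  - by apply: (measurableT_comp mG); exact: measurable_fun_pair.
  - exact: measurableX.
  move=> [x y] H; apply: (supported_within_box p0) => B; apply: H.
  by split; [have := B 0|have := B 1]; rewrite !mxE /I /= in_itv.
have iG' : (sfprod (@lebesgue_measure R) (@lebesgue_measure R) \x
  @lebesgue_measure R)%E.-integrable setT (fun p : mR3 => (F (row3 p))%:E) by exact: iG.
apply: (@iterated_integral_eq0 _ _ mR mR R lebesgue_measure lebesgue_measure
  _ mR lebesgue_measure _ iG' iS).
move: i dh ch h0 p0 @F HC iF iG iG' L mG iS.
apply: forall_ord3 => dh ch h0 p0 F HC iF iG iG' L mG iS.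
- apply: Or31 => y z.
  have r0 : row3 (0, y, z) 0 0 = 0 :> R by rewrite !mxE.
  rewrite -[RHS](L _ r0).
  apply: eq_integral => x _.
  congr (F _)%:E; apply/rowP; apply: forall_ord3; rewrite !mxE /=; ring.
- apply: Or32 => x z.
  have r0 : row3 (x, 0, z) 0 1 = 0 :> R by rewrite !mxE.
  rewrite -[RHS](L _ r0).
  apply: eq_integral => y _.
  congr (F _)%:E; apply/rowP; apply: forall_ord3; rewrite !mxE /=; ring.
- apply: Or33 => p.
  have r0 : row3 (p, 0) 0 2 = 0 :> R by rewrite !mxE.
  rewrite -[RHS](L _ r0).
  apply: eq_integral => z _.
  congr (F _)%:E; apply/rowP; apply: forall_ord3; rewrite !mxE /=; ring.
Qed.

End IntegrationByParts.

(** * Vector fields and weak curls *)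

Lemma ae_leb3S (R : realType) (P Q : 'rV[R]_3 -> Prop) :
  (forall x, P x -> Q x) -> {ae leb3, forall x, P x} -> {ae leb3, forall x, Q x}.
Proof. exact: (@filterS _ _ (ae_filter_ringOfSetsType leb3)). Qed.

Lemma ae_leb3S2 (R : realType) (P Q S : 'rV[R]_3 -> Prop) :
  (forall x, P x -> Q x -> S x) -> {ae leb3, forall x, P x} ->
  {ae leb3, forall x, Q x} -> {ae leb3, forall x, S x}.
Proof. exact: (@filterS2 _ _ (ae_filter_ringOfSetsType leb3)). Qed.

Section VectorL2.
Context {R : realType}.
Variable A : set 'rV[R]_3.
Hypothesis mA : lmeasurable A.
Implicit Types (f g h q : sfield R) (u v w : vfield R).

Lemma integrable_ip f g : L2 A f -> L2 A g ->
  leb3.-integrable A (EFin \o (fun x => f x * g x)).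
Proof. exact: square_integrableM. Qed.

Lemma L2_lin (a : R) f g : L2 A f -> L2 A g -> L2 A (a *: f + g).
Proof. exact: square_integrable_lin. Qed.

Lemma vL2_lin (a : R) u v : vL2 A u -> vL2 A v -> vL2 A (a *: u + v).
Proof.
move=> Lu Lv i.
rewrite (_ : vcoord _ i = a *: vcoord u i + vcoord v i); first exact: L2_lin.
by apply/funext => x; rewrite /vcoord !mxE.
Qed.

Lemma vL2_0 : vL2 A 0.
Proof.
move=> i; rewrite (_ : vcoord 0 i = fun=> 0); first exact: square_integrable0.
by apply/funext => x; rewrite /vcoord mxE.
Qed.

Lemma vL2B u v : vL2 A u -> vL2 A v -> vL2 A (u - v).
Proof. by move=> Lu Lv; rewrite addrC -scaleN1r; exact: vL2_lin. Qed.

Lemma vL2_smul q c u : lmeasurable_fun A q ->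
  {ae leb3, forall x, A x -> `|q x| <= c} -> vL2 A u -> vL2 A (smul q u).
Proof.
move=> mq qc Lu i.
rewrite (_ : vcoord _ i = (fun x => q x * vcoord u i x)).
  exact: square_integrable_mull qc (Lu i).
by apply/funext => x; rewrite /vcoord !mxE.
Qed.

Lemma integrable_dot u v : vL2 A u -> vL2 A v ->
  leb3.-integrable A (EFin \o (fun x => dot (u x) (v x))).
Proof.
move=> Lu Lv.
rewrite (_ : EFin \o _ = fun x => (\sum_(i < 3) (vcoord u i x * vcoord v i x)%:E)%E).
  by apply: integrable_sum => // i _; exact: integrable_ip.
by apply/funext => x /=; rewrite sumEFin.
Qed.

Lemma vipC u v : vip A u v = vip A v u.
Proof. by apply: eq_Rintegral => x _; apply: eq_bigr => i _; rewrite mulrC. Qed.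

Lemma vip_linl (a : R) u v w : vL2 A u -> vL2 A v -> vL2 A w ->
  vip A (a *: u + v) w = a * vip A u w + vip A v w.
Proof.
move=> Lu Lv Lw; rewrite /vip -RintegralZl//; last exact: integrable_dot.
rewrite -RintegralD//; last 2 first.
- have := integrableZl mA a (integrable_dot Lu Lw).
  by apply: eq_integrable.
- exact: integrable_dot.
apply: eq_Rintegral => x _; rewrite /dot mulr_sumr -big_split; apply: eq_bigr => i _ /=.
by rewrite !mxE; ring.
Qed.

Lemma vip_linr (a : R) u v w : vL2 A u -> vL2 A v -> vL2 A w ->
  vip A w (a *: u + v) = a * vip A w u + vip A w v.
Proof. by move=> *; rewrite vipC vip_linl// !(vipC w). Qed.

Lemma smul_lin q (a : R) u v : smul q (a *: u + v) = a *: smul q u + smul q v.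
Proof. by apply/funext => x; apply/rowP => i; rewrite !mxE; ring. Qed.

Lemma vip_smulC q u v : vip A (smul q u) v = vip A (smul q v) u.
Proof.
by apply: eq_Rintegral => x _; apply: eq_bigr => i _; rewrite !mxE; ring.
Qed.

Lemma vip_ge0 u : 0 <= vip A u u.
Proof. by apply: Rintegral_ge0 => x _; apply: sumr_ge0 => i _; exact: sqr_ge0. Qed.

Lemma vip_smul_le q c u : vL2 A (smul q u) -> vL2 A u ->
  {ae leb3, forall x, A x -> q x <= c} -> vip A (smul q u) u <= c * vip A u u.
Proof.
move=> Lqu Lu qc; rewrite /vip -RintegralZl//; last exact: integrable_dot.
apply: ae_le_Rintegral => //.
- exact: integrable_dot.
- by have := integrableZl mA c (integrable_dot Lu Lu); apply: eq_integrable.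
apply: ae_leb3S qc => x /[apply] qc; rewrite /dot mulr_sumr; apply: ler_sum => i _.
by rewrite !mxE -mulrA ler_wpM2r// -expr2 sqr_ge0.
Qed.

Lemma vip_smul_ge0 q u : vL2 A (smul q u) -> vL2 A u ->
  {ae leb3, forall x, A x -> 0 <= q x} -> 0 <= vip A (smul q u) u.
Proof.
move=> Lqu Lu q0.
have : 0 * vip A u u <= vip A (smul q u) u; last by rewrite mul0r.
rewrite /vip -RintegralZl//; last exact: integrable_dot.
apply: ae_le_Rintegral => //.
- by have := integrableZl mA 0 (integrable_dot Lu Lu); apply: eq_integrable.
- exact: integrable_dot.
apply: ae_leb3S q0 => x /[apply] q0; rewrite mul0r /dot; apply: sumr_ge0 => i _.
by rewrite !mxE -mulrA mulr_ge0// -expr2 sqr_ge0.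
Qed.

Lemma vip_ae_eql u v w : vL2 A u -> vL2 A v -> vL2 A w ->
  {ae leb3, forall x, A x -> u x = v x} -> vip A u w = vip A v w.
Proof.
move=> Lu Lv Lw uv.
have m1 : measurable_fun (A : set (R3L R)) (fun x => dot (u x) (w x)).
  by apply/measurable_EFinP; exact: measurable_int (integrable_dot Lu Lw).
have m2 : measurable_fun (A : set (R3L R)) (fun x => dot (v x) (w x)).
  by apply/measurable_EFinP; exact: measurable_int (integrable_dot Lv Lw).
apply: (ae_eq_Rintegral mA m1 m2).
by apply: ae_leb3S uv => x /[apply] ->.
Qed.

Lemma vL2norm_sqr u : vL2norm A u ^+ 2 = vip A u u.
Proof. by rewrite sqr_sqrtr ?vip_ge0. Qed.

End VectorL2.

Lemma lmeasurableS_L2 (R : realType) (A B : set 'rV[R]_3) u : lmeasurable A -> lmeasurable B ->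
  B `<=` A -> vL2 A u -> vL2 B u.
Proof. by move=> mA mB BA Lu i; exact: square_integrableS (Lu i). Qed.

Lemma vip_subset (R : realType) (A B : set 'rV[R]_3) u : lmeasurable A -> lmeasurable B ->
  B `<=` A -> vL2 A u -> vip B u u <= vip A u u.
Proof.
move=> mA mB BA Lu; rewrite /vip /Rintegral; apply: fine_le.
- by apply: integrable_fin_num => //; apply: integrable_dot => //; exact: lmeasurableS_L2 Lu.
- by apply: integrable_fin_num => //; exact: integrable_dot.
have m1 := measurable_int _ (integrable_dot mA Lu Lu).
have d0 x : A x -> (0 <= (EFin \o (fun x => dot (u x) (u x))) x)%E.
  by move=> _; rewrite lee_fin; apply: sumr_ge0 => i _; rewrite -expr2 sqr_ge0.
exact: (ge0_subset_integral leb3 mB mA m1 d0 BA).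
Qed.

(** * Calculus of smooth functions and test functions *)

Section WeakCurl.
Context {R : realType}.
Implicit Types (Om O : set 'rV[R]_3) (f g psi eta : sfield R) (E G u v : vfield R).

Lemma partialE f (i : 'I_3) x (l : R) : is_derive x (delta_mx 0 i) f l -> partial i f x = l.
Proof. by case. Qed.

Lemma smooth_derivable f (i : 'I_3) x : smooth_on setT f -> derivable f x (delta_mx 0 i).
Proof. by move=> sf; have [_] := sf [::] x I; apply. Qed.

Lemma smooth_continuous f : smooth_on setT f -> continuous f.
Proof. by move=> sf x; have [] := sf [::] x I. Qed.

Lemma smooth_partial f (i : 'I_3) : smooth_on setT f -> smooth_on setT (partial i f).
Proof. by move=> sf l x _; have := sf (rcons l i) x I; rewrite foldr_rcons. Qed.

Lemma smooth_lin (a : R) f g : smooth_on setT f -> smooth_on setT g ->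
  smooth_on setT (a *: f + g).
Proof.
move=> sf sg l x _.
have -> : foldr partial (a *: f + g) l = a *: foldr partial f l + foldr partial g l.
  elim: l => //= i l ->; apply/funext => y.
  apply: partialE; apply: is_deriveD; last by apply: derivableP; have [_] := sg l y I; apply.
  by apply: is_deriveZ; apply: derivableP; have [_] := sf l y I; apply.
have [cf df] := sf l x I; have [cg dg] := sg l x I; split.
  suff : {for x, continuous (fun y => a * foldr partial f l y + foldr partial g l y)} by [].
  by apply: continuousD cg; apply: continuousM cf; exact: cst_continuous.
by move=> i; apply: derivableD => //; exact: derivableZ.
Qed.

Lemma test_fun_lin O (a : R) f g : test_fun O f -> test_fun O g -> test_fun O (a *: f + g).
Proof.
move=> [sf kf fO] [sg kg gO].
apply: (@test_fun_supp _ _ (closure [set x | f x != 0] `|` closure [set x | g x != 0])).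
- exact: smooth_lin.
- by apply: closedU; exact: closed_closure.
- exact: compactU.
- by rewrite subUset.
move=> x fg0; have [fx|fx] := eqVneq (f x) 0; last by left; exact: subset_closure.
right; apply: subset_closure; rewrite /=; apply: contra_neq fg0 => gx.
by rewrite -[LHS]/(a * f x + g x) fx gx mulr0 addr0.
Qed.

Lemma partial_support f (i : 'I_3) x : partial i f x != 0 -> closure [set x | f x != 0] x.
Proof.
apply: contra_neqP => nx.
have H : \forall y \near x, f y = cst 0 y.
  have : open_nbhs x (~` closure [set x | f x != 0]).
    by split => //; apply: closed_openC; exact: closed_closure.
  move=> /open_nbhs_nbhs; apply: filterS => y ny; apply/eqP/negPn/negP => fy.
  by apply: ny; apply: subset_closure.
by rewrite /partial (near_eq_derive _ H) derive_cst.
Qed.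

Lemma test_fun_partial O f (i : 'I_3) : test_fun O f -> test_fun O (partial i f).
Proof.
move=> [sf kf fO]; apply: test_fun_supp kf fO _.
- exact: smooth_partial.
- exact: closed_closure.
- exact: partial_support.
Qed.

Lemma test_fun_supported O f : test_fun O f -> exists M, supported_within M f.
Proof.
move=> [_ /compact_bounded[M [_ HM]] _]; exists (M + 1) => x i xM; apply/eqP.
have M1 : M < M + 1 by rewrite ltrDl.
apply: contraTT xM => fx; rewrite -leNgt.
have cx : closure [set x | f x != 0] x by apply: subset_closure.
exact: le_trans (normr_coord_le x i) (HM _ M1 x cx).
Qed.

Lemma test_fun_out O f x : test_fun O f -> ~ O x -> f x = 0.
Proof.
move=> [_ _ fO] nO; apply/eqP/negPn/negP => fx.
by apply: nO; apply: fO; apply: subset_closure.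
Qed.

Lemma test_fun_integrableM O f g : test_fun O f -> test_fun O g ->
  leb3.-integrable setT (EFin \o (fun x => f x * g x)).
Proof.
move=> tf tg; have [M fM] := test_fun_supported tf.
have [sf _ _] := tf; have [sg _ _] := tg.
have cfg : continuous (fun x => f x * g x).
  by move=> x; apply: continuousM; exact: smooth_continuous.
have fgM : supported_within M (fun x => f x * g x).
  by move=> x i xM; rewrite (fM x i xM) mul0r.
have [C HC] := supported_within_bounded cfg fgM.
apply: (@bounded_support_integrable _ _ (R3L R) leb3 _ C
    (box (const_mx (- (`|M| + 1))) (const_mx (`|M| + 1))) _ HC) => [|||x].
- exact: continuous_lmeasurable_fun.
- exact: measurable_box.
- exact: leb3_box_lty.
- exact: supported_within_box fgM.
Qed.

Lemma ip_setT O f g : lmeasurable O -> test_fun O f -> ip O f g = ip setT f g.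
Proof.
move=> mO tf; rewrite /ip [LHS]Rintegral_mkcond; apply: eq_Rintegral => x _.
rewrite patchE; case: ifPn => //; rewrite notin_setE => nO.
by rewrite (test_fun_out tf nO) mul0r.
Qed.

(** Both integrals extend by zero to the whole space, where the integral of the i-th partial
    derivative of [f * g] vanishes; no boundary term of [O] ever appears. *)
Lemma ip_by_parts O f g (i : 'I_3) : lmeasurable O -> test_fun O f -> test_fun O g ->
  ip O f (partial i g) = - ip O (partial i f) g.
Proof.
move=> mO tf tg; have tpf := test_fun_partial i tf; have tpg := test_fun_partial i tg.
rewrite (ip_setT _ mO tf) (ip_setT _ mO tpf); apply/eqP; rewrite -addr_eq0; apply/eqP.
rewrite /ip -RintegralD//; [|exact: test_fun_integrableM tf tpg|exact: test_fun_integrableM tpf tg].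
have [sf _ _] := tf; have [sg _ _] := tg.
have pfg : partial i (fun x => f x * g x) = fun x => f x * partial i g x + partial i f x * g x.
  apply/funext => x; apply: partialE.
  have df := derivableP (@smooth_derivable f i x sf).
  have dg := derivableP (@smooth_derivable g i x sg).
  by have := is_deriveM df dg; rewrite /GRing.scale /= [g x * _]mulrC.
have cpfg x : {for x, continuous (fun x => f x * partial i g x + partial i f x * g x)}.
  have cf := smooth_continuous sf; have cg := smooth_continuous sg.
  have cpf := smooth_continuous (smooth_partial i sf).
  have cpg := smooth_continuous (smooth_partial i sg).
  exact: continuousD (continuousM (cf x) (cpg x)) (continuousM (cpf x) (cg x)).
have [M fM] := test_fun_supported tf.
have [M' pfM] := test_fun_supported tpf.
have := @integral_partial_eq0 R (fun x => f x * g x) i (Num.max M M').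
rewrite pfg => -[|||| _ H].
- move=> x; have df := @smooth_derivable f i x sf.
  by have := derivableM df (@smooth_derivable g i x sg).
- exact: cpfg.
- by move=> x j; rewrite gt_max => /andP[xM _]; rewrite (fM x j xM) mul0r.
- move=> x j; rewrite gt_max => /andP[xM xM'].
  by rewrite (fM x j xM) (pfM x j xM') !mul0r addr0.
by rewrite /Rintegral H.
Qed.

End WeakCurl.

(** * Weak curls on a bounded open set: consistency, uniqueness, linearity *)

Section WeakCurlSpaces.
Context {R : realType}.
Variable Om : set 'rV[R]_3.
Hypotheses (oO : open Om) (bO : bounded_set Om).
Implicit Types (f g : sfield R) (psi eta : vfield R) (E G u v w : vfield R).

Let mO : lmeasurable Om. Proof. exact: open_lmeasurable. Qed.

Lemma test_fun_L2 f : test_fun Om f -> L2 Om f.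
Proof.
move=> tf; have [sf _ _] := tf; split.
  by apply: continuous_lmeasurable_fun; exact: smooth_continuous.
have := integrableS measurableT mO (@subsetT _ Om) (test_fun_integrableM tf tf).
by apply: eq_integrable => // x _; rewrite /= expr2.
Qed.

Lemma test_field_vL2 psi : test_field Om psi -> vL2 Om psi.
Proof. by move=> tpsi i; exact: test_fun_L2. Qed.

Lemma test_field_lin (a : R) psi eta : test_field Om psi -> test_field Om eta ->
  test_field Om (a *: psi + eta).
Proof.
move=> tpsi teta i; rewrite (_ : vcoord _ i = a *: vcoord psi i + vcoord eta i).
  exact: test_fun_lin.
by apply/funext => x; rewrite /vcoord !mxE.
Qed.

Lemma test_field_curl psi : test_field Om psi -> test_field Om (curl psi).
Proof.
move=> tpsi i; rewrite (_ : vcoord _ i = -1 *: partial (i + 2) (vcoord psi (i + 1)) +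
    partial (i + 1) (vcoord psi (i + 2))).
  by apply: test_fun_lin; exact: test_fun_partial.
by apply/funext => x; rewrite /vcoord mxE scaleN1r addrC.
Qed.

Lemma vip_sum u v : vL2 Om u -> vL2 Om v ->
  vip Om u v = \sum_i ip Om (vcoord u i) (vcoord v i).
Proof.
move=> Lu Lv; rewrite /vip /ip /Rintegral.
under eq_integral do rewrite /dot -sumEFin.
rewrite integral_sum//; last by move=> i; exact: (integrable_ip mO (Lu i) (Lv i)).
rewrite (eq_bigr (fun i => (ip Om (vcoord u i) (vcoord v i))%:E)); first by rewrite sumEFin.
move=> i _; rewrite fineK//; apply: integrable_fin_num => //.
exact: (integrable_ip mO (Lu i) (Lv i)).
Qed.

Lemma ipBr f g h : L2 Om f -> L2 Om g -> L2 Om h ->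
  ip Om h (fun x => f x - g x) = ip Om h f - ip Om h g.
Proof.
move=> Lf Lg Lh; rewrite /ip -RintegralB//; try exact: integrable_ip.
by apply: eq_Rintegral => x _; rewrite mulrBr.
Qed.

Lemma ipC f g : ip Om f g = ip Om g f.
Proof. by apply: eq_Rintegral => x _; rewrite mulrC. Qed.

Lemma sum_cyclic (F : 'I_3 -> 'I_3 -> 'I_3 -> R) :
  \sum_i F i (i + 1) (i + 2) = F 0 1 2 + F 1 2 0 + F 2 0 1.
Proof.
by rewrite !big_ord_recl big_ord0 addr0 addrA; congr (F _ _ _ + F _ _ _ + F _ _ _);
  exact: val_inj.
Qed.

(** The index bookkeeping of Green's formula for the curl: a cyclic relabelling, indices adding
    modulo 3. *)
Lemma sum_curl_swap (F : 'I_3 -> 'I_3 -> 'I_3 -> R) :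
  \sum_i (- F (i + 2) (i + 1) i - - F (i + 1) (i + 2) i) =
  \sum_i (F i (i + 1) (i + 2) - F i (i + 2) (i + 1)).
Proof.
rewrite (sum_cyclic (fun i j k => - F k j i - - F j k i)).
rewrite (sum_cyclic (fun i j k => F i j k - F i k j)); ring.
Qed.

(** Green's formula, one partial derivative at a time. It places test fields in [Hcurl], so that the
    triangle inequality applies to the differences [E - psi] in the definition of [H0curl]. *)
Lemma is_wcurl_test psi : test_field Om psi -> is_wcurl Om psi (curl psi).
Proof.
move=> tpsi eta teta.
have tc := test_field_curl tpsi; have td := test_field_curl teta.
have L := test_field_vL2.
rewrite !vip_sum//; try exact: L.
have C (xi : vfield R) i : vcoord (curl xi) i = fun x =>
    partial (i + 1) (vcoord xi (i + 2)) x - partial (i + 2) (vcoord xi (i + 1)) x.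
  by apply/funext => x; rewrite /vcoord mxE.
have T (xi : vfield R) i j : test_field Om xi -> L2 Om (partial i (vcoord xi j)).
  by move=> txi; apply: test_fun_L2; exact: test_fun_partial.
have K (i j k : 'I_3) : ip Om (vcoord psi i) (partial j (vcoord eta k)) =
    - ip Om (vcoord eta k) (partial j (vcoord psi i)).
  by rewrite ip_by_parts// ipC.
have P (xi zeta : vfield R) i : test_field Om xi -> test_field Om zeta ->
    ip Om (vcoord xi i) (vcoord (curl zeta) i) =
    ip Om (vcoord xi i) (partial (i + 1) (vcoord zeta (i + 2))) -
    ip Om (vcoord xi i) (partial (i + 2) (vcoord zeta (i + 1))).
  move=> txi tzeta; rewrite C; apply: ipBr; [exact: T|exact: T|exact: L].
under eq_bigr => i _ do rewrite P// !K.
under [RHS]eq_bigr => i _ do rewrite ipC P//.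
exact: (sum_curl_swap (fun j k i => ip Om (vcoord eta j) (partial k (vcoord psi i)))).
Qed.

Lemma is_wcurl_lin (a : R) E G v w : vL2 Om E -> vL2 Om G -> vL2 Om v -> vL2 Om w ->
  is_wcurl Om E v -> is_wcurl Om G w -> is_wcurl Om (a *: E + G) (a *: v + w).
Proof.
move=> LE LG Lv Lw Ev Gw psi tpsi.
have Lpsi := test_field_vL2 tpsi; have Lc := test_field_vL2 (test_field_curl tpsi).
by rewrite !vip_linl// Ev// Gw.
Qed.

Lemma L2_integrable f : L2 Om f -> leb3.-integrable Om (EFin \o f).
Proof.
move=> Lf.
have L1 : L2 Om (fun=> 1).
  split; first exact: measurable_cst.
  apply: (@measurable_bounded_integrable _ (R3L R) R leb3 (fun=> 1 ^+ 2)) => //.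
  - exact: bounded_leb3_lty.
  - by exists 1; split; [exact: num_real|move=> M M1 x _ /=; rewrite expr1n normr1 ltW].
have := integrable_ip mO Lf L1; apply: eq_integrable => // x _.
by rewrite /= mulr1.
Qed.

Lemma is_wcurl_unique E v w : vL2 Om v -> vL2 Om w ->
  is_wcurl Om E v -> is_wcurl Om E w -> {ae leb3, forall x, Om x -> v x = w x}.
Proof.
move=> Lv Lw Ev Ew.
have H i : {ae leb3, forall x, Om x -> vcoord (-1 *: v + w) i x = 0}.
  have Lvw := vL2_lin mO (-1) Lv Lw.
  apply: (fundamental_lemma oO); first exact: L2_integrable.
  move=> phi tphi; pose psi : vfield R := fun x => phi x *: delta_mx 0 i.
  have tpsi : test_field Om psi.
    (* One linear combination covers the component [i] and the zero components alike. *)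
    move=> j; rewrite (_ : vcoord psi j = (j == i)%:R *: phi + 0 *: phi).
      have t0 : test_fun Om (0 *: phi).
        by have := test_fun_lin (-1) tphi tphi; rewrite scaleN1r addNr scale0r.
      exact: test_fun_lin.
    by apply/funext => x; rewrite /vcoord !mxE eqxx scale0r addr0 -[RHS]/(_ * _) mulrC.
  have <- : vip Om (-1 *: v + w) psi = ip Om (vcoord (-1 *: v + w) i) phi.
    apply: eq_Rintegral => x _; rewrite /dot (bigD1 i)//= big1 ?addr0.
      by rewrite /vcoord !mxE !eqxx mulr1.
    by move=> j ji; rewrite !mxE (negbTE ji) ?andbF !mulr0.
  by rewrite vip_linl//; [rewrite -Ev// -Ew// mulN1r addNr|exact: test_field_vL2].
have := ae_forall_countable H; apply: ae_leb3S => x Hx Ox; apply/rowP => i.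
by have := Hx i Ox; rewrite /vcoord !mxE mulN1r addrC => /eqP; rewrite subr_eq0 => /eqP.
Qed.

Lemma wcurlP E : Hcurl Om E -> vL2 Om (wcurl Om E) /\ is_wcurl Om E (wcurl Om E).
Proof.
move=> [_ [v Hv]]; rewrite /wcurl.
exact: (@xgetPex _ 0 [set v | vL2 Om v /\ is_wcurl Om E v] (ex_intro _ v Hv)).
Qed.

(** Holds for every [E], since [xget] falls back on 0 when no weak curl exists; [curl_form] is
    thereby linear in one argument whatever the other is. *)
Lemma vL2_wcurl E : vL2 Om (wcurl Om E).
Proof.
rewrite /wcurl; case: xgetP => [v _ []//|_]; exact: vL2_0.
Qed.

Lemma Hcurl_lin (a : R) E G : Hcurl Om E -> Hcurl Om G -> Hcurl Om (a *: E + G).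
Proof.
move=> HE HG; have [Lv Ev] := wcurlP HE; have [Lw Gw] := wcurlP HG.
have [LE _] := HE; have [LG _] := HG.
split; first exact: vL2_lin.
by exists (a *: wcurl Om E + wcurl Om G); split; [exact: vL2_lin|exact: is_wcurl_lin].
Qed.

Lemma wcurl_lin (a : R) E G : Hcurl Om E -> Hcurl Om G ->
  {ae leb3, forall x, Om x -> wcurl Om (a *: E + G) x = (a *: wcurl Om E + wcurl Om G) x}.
Proof.
move=> HE HG; have [Lv Ev] := wcurlP HE; have [Lw Gw] := wcurlP HG.
have [LE _] := HE; have [LG _] := HG.
have [L C] := wcurlP (Hcurl_lin a HE HG).
by apply: (is_wcurl_unique _ _ C); [|exact: vL2_lin|exact: is_wcurl_lin].
Qed.

Lemma test_field_Hcurl psi : test_field Om psi -> Hcurl Om psi.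
Proof.
move=> tpsi; split; first exact: test_field_vL2.
exists (curl psi); split; last exact: is_wcurl_test.
by apply: test_field_vL2; exact: test_field_curl.
Qed.

End WeakCurlSpaces.

(** * The H(curl) norm, residuals and weighted forms *)

Lemma form_triangle (R : rcfType) (V : lmodType R) (S : set V) (B : V -> V -> R) :
  (forall a u v, S u -> S v -> S (a *: u + v)) ->
  (forall a u v w, S u -> S v -> S w -> B (a *: u + v) w = a * B u w + B v w) ->
  (forall u v, S u -> S v -> B u v = B v u) ->
  (forall u, S u -> 0 <= B u u) ->
  forall a u v, S u -> S v ->
  Num.sqrt (B (a *: u + v) (a *: u + v)) <=
    `|a| * Num.sqrt (B u u) + Num.sqrt (B v v).
Proof.
move=> Sl Bl Bs B0 a u v Su Sv.
have CS := form_cauchy_schwarz Sl Bl Bs B0 Su Sv.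
have S1 := Sl a u v Su Sv.
rewrite -[leRHS]ger0_norm ?addr_ge0 ?mulr_ge0 ?sqrtr_ge0// -sqrtr_sqr ler_wsqrtr//.
rewrite Bl// (Bs u)// (Bs v)// !Bl// (Bs v u)//.
rewrite sqrrD exprMn !sqr_sqrtr ?B0// real_normK ?num_real//.
have H : a * B u v <= `|a| * Num.sqrt (B u u) * Num.sqrt (B v v).
  apply: le_trans (ler_norm _) _; rewrite normrM -mulrA ler_wpM2l//.
  by rewrite -sqrtrM ?B0// -sqrtr_sqr ler_wsqrtr.
by rewrite mulr2n; lra.
Qed.

Section HcurlNorm.
Context {R : realType}.
Variable Om : set 'rV[R]_3.
Hypotheses (oO : open Om) (bO : bounded_set Om).
Implicit Types (E G H : vfield R) (X : set (vfield R)).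

Let mO : lmeasurable Om. Proof. exact: open_lmeasurable. Qed.

Definition Hcurl_form E G := vip Om E G + vip Om (wcurl Om E) (wcurl Om G).

Lemma Hcurl_form_linl (a : R) E G H : Hcurl Om E -> Hcurl Om G -> Hcurl Om H ->
  Hcurl_form (a *: E + G) H = a * Hcurl_form E H + Hcurl_form G H.
Proof.
move=> HE HG HH; have [LE _] := HE; have [LG _] := HG; have [LH _] := HH.
have L F : vL2 Om (wcurl Om F) by exact: vL2_wcurl.
rewrite /Hcurl_form vip_linl//.
rewrite (vip_ae_eql mO _ _ _ (wcurl_lin oO bO a HE HG)); [|exact: L|exact: vL2_lin|exact: L].
by rewrite vip_linl// mulrDr addrACA.
Qed.

Lemma Hcurl_form_ge0 E : 0 <= Hcurl_form E E.
Proof. by rewrite addr_ge0// vip_ge0. Qed.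

Lemma Hcurl_formC E G : Hcurl_form E G = Hcurl_form G E.
Proof. by rewrite /Hcurl_form vipC [vip _ (wcurl _ _) _]vipC. Qed.

Lemma Hcurl_normE E : Hcurl_norm Om E = Num.sqrt (Hcurl_form E E).
Proof. by rewrite /Hcurl_norm !vL2norm_sqr. Qed.

Lemma Hcurl_norm_lin (a : R) E G : Hcurl Om E -> Hcurl Om G ->
  Hcurl_norm Om (a *: E + G) <= `|a| * Hcurl_norm Om E + Hcurl_norm Om G.
Proof.
rewrite !Hcurl_normE; apply: (form_triangle (S := Hcurl Om)).
- by move=> b u v; exact: Hcurl_lin.
- exact: Hcurl_form_linl.
- by move=> *; exact: Hcurl_formC.
- by move=> *; exact: Hcurl_form_ge0.
Qed.

Lemma Hcurl_normZ_le (a : R) E : Hcurl Om E -> Hcurl_norm Om (a *: E) <= `|a| * Hcurl_norm Om E.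
Proof.
(* This splitting derives homogeneity from the rule for [a *: E + G] alone, without a zero field. *)
move=> HE; have aE : a *: E = (a - 1) *: E + E by rewrite scalerBl scale1r subrK.
have HaE : Hcurl Om (a *: E) by rewrite aE; exact: Hcurl_lin.
have Z G : Hcurl Om G -> Hcurl_form (a *: E) G = a * Hcurl_form E G.
  by move=> HG; rewrite aE Hcurl_form_linl// mulrBl mul1r subrK.
rewrite !Hcurl_normE Z// Hcurl_formC Z// mulrA -expr2 sqrtrM ?sqr_ge0//.
by rewrite sqrtr_sqr.
Qed.

Lemma vL2norm_le_Hcurl E : vL2norm Om E <= Hcurl_norm Om E.
Proof. by rewrite ler_wsqrtr// vL2norm_sqr lerDl sqr_ge0. Qed.

Lemma wcurl_norm_le_Hcurl E : vL2norm Om (wcurl Om E) <= Hcurl_norm Om E.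
Proof. by rewrite ler_wsqrtr// !vL2norm_sqr lerDr vip_ge0. Qed.

Lemma H0curl_lin (a : R) E G : H0curl Om E -> H0curl Om G -> H0curl Om (a *: E + G).
Proof.
move=> [HE DE] [HG DG]; split; first exact: Hcurl_lin.
move=> e e0.
have a1 : 0 < `|a| + 1 by rewrite ltr_wpDl.
have [|psi tpsi E1] := DE (e / 2 / (`|a| + 1)); first by rewrite !divr_gt0.
have [|eta teta G1] := DG (e / 2); first by rewrite divr_gt0.
have Hsub F phi : Hcurl Om F -> test_field Om phi -> Hcurl Om (F - phi).
  move=> HF tphi; rewrite addrC -scaleN1r; apply: Hcurl_lin => //.
  exact: test_field_Hcurl.
exists (a *: psi + eta); first exact: test_field_lin.
have -> : a *: E + G - (a *: psi + eta) = a *: (E - psi) + (G - eta).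
  by rewrite scalerBr opprD addrACA.
apply: le_lt_trans (Hcurl_norm_lin _ (Hsub _ _ HE tpsi) (Hsub _ _ HG teta)) _.
rewrite [ltRHS](splitr e) ler_ltD//.
apply: (@le_trans _ _ ((`|a| + 1) * Hcurl_norm Om (E - psi))).
  by rewrite ler_wpM2r ?sqrtr_ge0// lerDl.
by rewrite -ler_pdivlMl// mulrC ltW.
Qed.

Lemma nedelec_lin (T : mesh) (a : R) E G : nedelec_space Om T E -> nedelec_space Om T G ->
  nedelec_space Om T (a *: E + G).
Proof.
move=> [HE aE] [HG aG]; split; first exact: H0curl_lin.
move=> t tT; have [a1 [b1 E1]] := aE t tT; have [a2 [b2 E2]] := aG t tT.
exists (a *: a1 + a2), (a *: b1 + b2).
apply: ae_leb3S2 E1 E2 => x E1 E2 hx.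
rewrite -[LHS]/(a *: E x + G x) E1// E2//.
by apply/rowP => i; rewrite !mxE; ring.
Qed.

Lemma nedelec_Hcurl (T : mesh) E : nedelec_space Om T E -> Hcurl Om E.
Proof. by move=> [[]]. Qed.

Lemma dual_norm_ge0 X (r : vfield R -> R) : 0 <= dual_norm Om X r.
Proof.
rewrite /dual_norm; set S := (X in sup X).
have [hS|nS] := pselect (has_sup S); last by rewrite sup_out.
have [[z [G GX _]] uS] := hS.
by apply: le_trans (normr_ge0 (r G)) _; apply: ub_le_sup => //; exists G.
Qed.

(** The continuity constant [K] is absent from the conclusion but does two things: it bounds the set
    under [sup], which is 0 on unbounded sets, and it gives [r G = 0] when [G] has norm 0 and cannot
    be rescaled. *)
Lemma dual_norm_le X (r : vfield R -> R) (K : R) G :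
  (forall a E, X E -> X (a *: E)) -> X `<=` Hcurl Om ->
  (forall a E, X E -> r (a *: E) = a * r E) ->
  (forall E, X E -> `|r E| <= K * Hcurl_norm Om E) ->
  X G -> `|r G| <= dual_norm Om X r * Hcurl_norm Om G.
Proof.
move=> XZ XH rZ rK XG.
have [n0|n0] := eqVneq (Hcurl_norm Om G) 0.
  by have := rK G XG; rewrite n0 !mulr0.
have np : 0 < Hcurl_norm Om G by rewrite lt_def n0 sqrtr_ge0.
have K0 : 0 <= K by have := le_trans (normr_ge0 _) (rK G XG); rewrite pmulr_lge0.
rewrite -ler_pdivrMr//; apply: ub_le_sup.
  exists K => _ [E [XE E1] <-]; apply: le_trans (rK E XE) _.
  by rewrite ler_piMr.
exists ((Hcurl_norm Om G)^-1 *: G).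
  split; first exact: XZ.
  apply: le_trans (Hcurl_normZ_le _ (XH _ XG)) _.
  by rewrite ger0_norm ?mulVf ?invr_ge0 ?lexx ?(ltW np).
by rewrite rZ// normrM [`|_^-1|]ger0_norm ?invr_ge0 ?ltW// mulrC.
Qed.

Lemma dual_norm_eq0 X (r : vfield R -> R) : (forall E, X E -> r E = 0) -> dual_norm Om X r = 0.
Proof.
move=> r0; apply/eqP; rewrite eq_le dual_norm_ge0 andbT /dual_norm; set S := (X in sup X).
have [hS|nS] := pselect (has_sup S); last by rewrite sup_out.
by apply: ge_sup => [|_ [G [XG _] <-]]; [exact: hS.1|rewrite r0// normr0].
Qed.

End HcurlNorm.

Section WeightedForm.
Context {R : realType}.
Variables (A : set 'rV[R]_3) (q : sfield R) (c : R).
Hypotheses (mA : lmeasurable A) (mq : lmeasurable_fun A q) (c0 : 0 <= c).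
Hypothesis q0c : {ae leb3, forall x, A x -> 0 <= q x <= c}.
Implicit Types u v w : vfield R.

Let q0 : {ae leb3, forall x, A x -> 0 <= q x}.
Proof. by apply: ae_leb3S q0c => x /[apply] /andP[]. Qed.

Let qc : {ae leb3, forall x, A x -> q x <= c}.
Proof. by apply: ae_leb3S q0c => x /[apply] /andP[]. Qed.

Lemma vL2_weight u : vL2 A u -> vL2 A (smul q u).
Proof.
apply: (@vL2_smul _ _ mA _ c) => //; apply: ae_leb3S q0c => x /[apply] /andP[? ?].
by rewrite ger0_norm.
Qed.

Lemma weight_linl (a : R) u v w : vL2 A u -> vL2 A v -> vL2 A w ->
  vip A (smul q (a *: u + v)) w = a * vip A (smul q u) w + vip A (smul q v) w.
Proof. by move=> Lu Lv Lw; rewrite smul_lin vip_linl//; exact: vL2_weight. Qed.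

Lemma weight_linr (a : R) u v w : vL2 A u -> vL2 A v -> vL2 A w ->
  vip A (smul q w) (a *: u + v) = a * vip A (smul q w) u + vip A (smul q w) v.
Proof. by move=> Lu Lv Lw; rewrite vip_linr//; exact: vL2_weight. Qed.

Lemma weightBl u v w : vL2 A u -> vL2 A v -> vL2 A w ->
  vip A (smul q (u - v)) w = vip A (smul q u) w - vip A (smul q v) w.
Proof. by move=> *; rewrite addrC -scaleN1r weight_linl// mulN1r addrC. Qed.

Lemma weightBr u v w : vL2 A u -> vL2 A v -> vL2 A w ->
  vip A (smul q w) (u - v) = vip A (smul q w) u - vip A (smul q w) v.
Proof. by move=> *; rewrite vip_smulC weightBl// ![vip A (smul q w) _]vip_smulC. Qed.

Lemma weightZr (b : R) u w : vL2 A u -> vL2 A w ->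
  vip A (smul q w) (b *: u) = b * vip A (smul q w) u.
Proof.
by move=> *; rewrite -[b in LHS](subrK 1) scalerDl scale1r weight_linr// mulrBl mul1r subrK.
Qed.

Lemma weight_sqrB u v : vL2 A u -> vL2 A v -> vip A (smul q (u - v)) (u - v) =
  vip A (smul q u) u - 2 * vip A (smul q u) v + vip A (smul q v) v.
Proof.
move=> Lu Lv; have Luv := vL2B mA Lu Lv.
rewrite weightBl// !weightBr// (vip_smulC A q v u); move: (vip _ _ _) => x; ring.
Qed.

Lemma weight_ge0 u : vL2 A u -> 0 <= vip A (smul q u) u.
Proof. by move=> Lu; apply: vip_smul_ge0 => //; exact: vL2_weight. Qed.

Lemma weight_le u : vL2 A u -> vip A (smul q u) u <= c * vL2norm A u ^+ 2.
Proof. by move=> Lu; rewrite vL2norm_sqr; apply: vip_smul_le => //; exact: vL2_weight. Qed.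

Lemma weight_cauchy_schwarz u v : vL2 A u -> vL2 A v ->
  vip A (smul q u) v ^+ 2 <= vip A (smul q u) u * vip A (smul q v) v.
Proof.
apply: (form_cauchy_schwarz (S := vL2 A) (B := fun u v => vip A (smul q u) v)).
- exact: vL2_lin.
- exact: weight_linl.
- by move=> *; exact: vip_smulC.
- exact: weight_ge0.
Qed.

Lemma weight_norm_le u v : vL2 A u -> vL2 A v ->
  `|vip A (smul q u) v| <= c * vL2norm A u * vL2norm A v.
Proof.
move=> Lu Lv; rewrite -[leRHS]ger0_norm ?mulr_ge0 ?sqrtr_ge0//.
rewrite -!sqrtr_sqr ler_wsqrtr//; apply: le_trans (weight_cauchy_schwarz Lu Lv) _.
have -> : (c * vL2norm A u * vL2norm A v) ^+ 2 =
  (c * vL2norm A u ^+ 2) * (c * vL2norm A v ^+ 2) by ring.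
by apply: ler_pM; rewrite ?weight_ge0 ?weight_le.
Qed.

Lemma vL2_sqrt_weight u : vL2 A u -> vL2 A (smul (sqrt_fun q) u).
Proof.
apply: (@vL2_smul _ _ mA _ (Num.sqrt c)).
  have ms : measurable_fun [set: R] (@Num.sqrt R).
    by apply: continuous_measurable_fun; exact: sqrt_continuous.
  exact: measurableT_comp ms mq.
apply: ae_leb3S q0c => x /[apply] /andP[? ?].
by rewrite ger0_norm ?sqrtr_ge0// ler_wsqrtr.
Qed.

Lemma vL2norm_sqrt_weight u : vL2 A u ->
  vL2norm A (smul (sqrt_fun q) u) ^+ 2 = vip A (smul q u) u.
Proof.
move=> Lu; have Lsu := vL2_sqrt_weight Lu; rewrite vL2norm_sqr.
have m1 : measurable_fun (A : set (R3L R))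
    (fun x => dot (smul (sqrt_fun q) u x) (smul (sqrt_fun q) u x)).
  by apply/measurable_EFinP; exact: measurable_int (integrable_dot mA Lsu Lsu).
have m2 : measurable_fun (A : set (R3L R)) (fun x => dot (smul q u x) (u x)).
  by apply/measurable_EFinP; exact: measurable_int (integrable_dot mA (vL2_weight Lu) Lu).
apply: (ae_eq_Rintegral mA m1 m2); apply: ae_leb3S q0 => x /[apply] qx.
apply: eq_bigr => i _; rewrite !mxE mulrACA -expr2.
by rewrite /sqrt_fun sqr_sqrtr// mulrA.
Qed.

End WeightedForm.

Lemma vL2norm_triangle (R : realType) (A : set 'rV[R]_3) (u v : vfield R) : lmeasurable A ->
  vL2 A u -> vL2 A v -> vL2norm A (u - v) <= vL2norm A u + vL2norm A v.
Proof.
move=> mA Lu Lv.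
have := @form_triangle R _ (vL2 A) (vip A) (vL2_lin mA) (vip_linl mA)
  (fun u v _ _ => vipC A u v) (fun u _ => vip_ge0 A u) (-1) v u Lv Lu.
by rewrite normrN1 mul1r scaleN1r addrC [leRHS]addrC.
Qed.

(** The identity (p + q)^2 = 4pq + (p - q)^2 with p = K/(2 alpha) and q = alpha y^2 / 2, for which
    4pq = K y^2; working with squares avoids the root of [K]. *)
Lemma young_bound (R : realFieldType) (t y K alpha : R) : 0 < alpha -> 0 <= K ->
  t ^+ 2 <= K * y ^+ 2 -> t - alpha / 2 * y ^+ 2 <= K / (2 * alpha).
Proof.
move=> a0 K0 tK.
have SE : (K / (2 * alpha) + alpha / 2 * y ^+ 2) ^+ 2 =
  K * y ^+ 2 + (K / (2 * alpha) - alpha / 2 * y ^+ 2) ^+ 2 by field; rewrite gt_eqF.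
rewrite lerBlDr; move: SE; set S := (X in X ^+ 2 = _) => SE.
have S0 : 0 <= S.
  have a0' := ltW a0.
  by rewrite /S; apply: addr_ge0; [rewrite divr_ge0// mulr_ge0|rewrite mulr_ge0 ?sqr_ge0// divr_ge0].
have tS : t ^+ 2 <= S ^+ 2 by rewrite SE (le_trans tK)// lerDl sqr_ge0.
rewrite leNgt; apply/negP => St.
have : S ^+ 2 < t ^+ 2 by rewrite ltr_pXn2r ?nnegrE// (le_trans S0 (ltW St)).
by rewrite ltNge tS.
Qed.

(* The bound is linear in [r] because the two estimates of [t], one by the
   residual norm [r] and one a priori, are combined geometrically. *)
Lemma quadratic_gap (R : rcfType) (t n W r C c B alpha : R) :
  0 < alpha -> 0 <= c -> 0 <= C -> 0 <= B -> 0 <= r -> 0 <= W ->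
  t ^+ 2 <= r ^+ 2 * n ^+ 2 -> n ^+ 2 <= C ^+ 2 * c * W ->
  t ^+ 2 <= W * (c * (2 * (C * c * B)) ^+ 2) ->
  t - alpha / 2 * W <= r * (C ^+ 2 * c ^+ 2 * B / alpha).
Proof.
move=> a0 c0 C0 B0 r0 W0 t1 n1 t2.
(* The geometric mean of the coefficients [r ^+ 2 * (C ^+ 2 * c)] and [c * (2 * (C * c * B)) ^+ 2]
   of [W] in the two estimates. *)
set K := 2 * r * (C ^+ 2 * c ^+ 2 * B).
have K0 : 0 <= K by rewrite /K !mulr_ge0// exprn_ge0.
have tK : t ^+ 2 <= K * W.
  rewrite -ler_sqr ?nnegrE ?sqr_ge0 ?mulr_ge0//.
  have -> : (K * W) ^+ 2 = (r ^+ 2 * (C ^+ 2 * c * W)) * (W * (c * (2 * (C * c * B)) ^+ 2)).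
    by rewrite /K; ring.
  rewrite expr2; apply: ler_pM; rewrite ?sqr_ge0//.
  by apply: le_trans t1 _; rewrite ler_wpM2l// sqr_ge0.
have := @young_bound R t (Num.sqrt W) K alpha a0 K0.
rewrite sqr_sqrtr// => /(_ tK) /le_trans; apply.
rewrite le_eqVlt; apply/orP; left; apply/eqP.
by rewrite /K; field; rewrite gt_eqF.
Qed.

Section CurlForm.
Context {R : realType}.
Variables (Om : set 'rV[R]_3) (sigma : sfield R) (k : R).
Hypotheses (oO : open Om) (bO : bounded_set Om) (k0 : 0 <= k).
Hypothesis ms : lmeasurable_fun Om (recip sigma).
Hypothesis sk : {ae leb3, forall x, Om x -> 0 <= recip sigma x <= k}.
Implicit Types E G H : vfield R.

Let mO : lmeasurable Om. Proof. exact: open_lmeasurable. Qed.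

Lemma curl_formC E G : curl_form Om sigma E G = curl_form Om sigma G E.
Proof. exact: vip_smulC. Qed.

Lemma curl_form_linl (a : R) E G H : Hcurl Om E -> Hcurl Om G ->
  curl_form Om sigma (a *: E + G) H = a * curl_form Om sigma E H + curl_form Om sigma G H.
Proof.
move=> HE HG; have L F : vL2 Om (wcurl Om F) by exact: vL2_wcurl.
rewrite /curl_form -(weight_linl mO ms sk)//.
apply: (vip_ae_eql mO); [|exact: (vL2_weight mO ms sk (vL2_lin mO a (L E) (L G)))|exact: L|].
  exact: (vL2_weight mO ms sk (L _)).
by apply: ae_leb3S (wcurl_lin oO bO a HE HG) => x /[apply]; rewrite /smul => ->.
Qed.

Lemma curl_formZl (a : R) E H : Hcurl Om E ->
  curl_form Om sigma (a *: E) H = a * curl_form Om sigma E H.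
Proof.
move=> HE; rewrite -[a in LHS](subrK 1) scalerDl scale1r curl_form_linl//.
by rewrite mulrBl mul1r subrK.
Qed.

Lemma curl_formBl E G H : Hcurl Om E -> Hcurl Om G ->
  curl_form Om sigma (E - G) H = curl_form Om sigma E H - curl_form Om sigma G H.
Proof. by move=> HE HG; rewrite addrC -scaleN1r curl_form_linl// mulN1r addrC. Qed.

Lemma curl_form_norm_le E G :
  `|curl_form Om sigma E G| <= k * Hcurl_norm Om E * Hcurl_norm Om G.
Proof.
have L F : vL2 Om (wcurl Om F) by exact: vL2_wcurl.
apply: le_trans (weight_norm_le mO ms k0 sk (L E) (L G)) _.
apply: ler_pM; rewrite ?mulr_ge0 ?sqrtr_ge0//; last exact: wcurl_norm_le_Hcurl.
by rewrite ler_wpM2l// wcurl_norm_le_Hcurl.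
Qed.

End CurlForm.

(** * The cost gap *)

Lemma subr_swap (V : zmodType) (x y z t : V) : y - t = (x - t) - ((x - z) - (y - z)).
Proof.
have -> : (x - z) - (y - z) = x - y by rewrite opprB addrA subrK.
by rewrite opprB [RHS]addrC addrA subrK.
Qed.

(** Here [p0], [ps], [pa] pair the observation error of E_h with itself, with s and with a; [psa] is
    the square of s - a. Likewise [q0] is the square of u_h - u_d, [y] its pairing with u_h - u_N,
    and [W] the square of u_h - u_N. The left side is [ps - pa - psa/2 + al * y - al/2 * W], and the
    variational inequality removes [ps]. *)
Lemma upper_gap_arith (R : realFieldType) (al p0 ps pa psa q0 y W m : R) :
  - al * - y <= - ps -> 0 <= psa -> 0 <= al / 2 * W -> - pa <= m ->
  2^-1 * p0 + al / 2 * q0 -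
    (2^-1 * (p0 - 2 * (ps - pa) + psa) + al / 2 * (q0 - 2 * y + W)) <= m.
Proof. lra. Qed.

(** The same expansion at (u_N, E_N). Now [g] pairs u_h - u_N with F_N while [ps] equals its pairing
    with Fhat, so they no longer cancel; [- al / 2 * W] is kept to absorb [g - ps]. *)
Lemma lower_gap_arith (R : realFieldType) (al p0 ps pa psa q0 y W g m m' : R) :
  - al * y <= g -> 0 <= psa -> pa <= m -> g - ps - al / 2 * W <= m' ->
  2^-1 * p0 + al / 2 * q0 -
    (2^-1 * (p0 - 2 * (pa - ps) + psa) + al / 2 * (q0 - 2 * - y + W)) <= m + m'.
Proof. lra. Qed.

Section CostGap.
Context {R : realType}.
Variables (Om D : set 'rV[R]_3) (sigma eps rho : sfield R) (Ed ud : vfield R).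
Variables (X EN U : set (vfield R)) (Y VN : set (sfield R)).
Variables (alpha c k C CE e_d : R).
Hypotheses (oO : open Om) (bO : bounded_set Om) (DO : D `<=` Om) (mD : lmeasurable D).
Hypotheses (a0 : 0 < alpha) (c0 : 0 <= c) (k0 : 0 <= k) (C0 : 0 < C).
Hypotheses (me : lmeasurable_fun Om eps) (ms : lmeasurable_fun Om (recip sigma)).
Hypothesis ec : {ae leb3, forall x, Om x -> 0 <= eps x <= c}.
Hypothesis sk : {ae leb3, forall x, Om x -> 0 <= recip sigma x <= k}.
Hypotheses (LEd : vL2 D Ed) (Lud : vL2 Om ud) (Ed_le : vL2norm D Ed <= e_d).
Hypothesis XH : X `<=` Hcurl Om.
Hypothesis X_lin : forall a E G, X E -> X G -> X (a *: E + G).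
Hypothesis ENX : EN `<=` X.
Hypothesis UL2 : U `<=` vL2 Om.
Hypotheses (coerX : coercive Om X Y sigma eps C) (coerN : coercive Om EN VN sigma eps C).

Variables uh Eh Fh uN ENs FN Ehat Fhat : vfield R.
Hypothesis opt_h : optimality_system Om D U X Y alpha sigma eps rho Ed ud uh Eh Fh.
Hypothesis opt_N : optimality_system Om D U EN VN alpha sigma eps rho Ed ud uN ENs FN.
Hypothesis Ehat_def : state_system Om X Y sigma eps rho uN Ehat.
Hypothesis Fhat_def : adjoint_system Om D X Y sigma eps Ed ENs Fhat.
Hypotheses (Eh_le : Hcurl_norm Om Eh <= CE) (EN_le : Hcurl_norm Om ENs <= CE).

Let mO : lmeasurable Om. Proof. exact: open_lmeasurable. Qed.
Let meD : lmeasurable_fun D eps.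
Proof. exact: (measurable_funS mO DO me). Qed.
Let ecD : {ae leb3, forall x, D x -> 0 <= eps x <= c}.
Proof. by apply: ae_leb3S ec => x H /DO. Qed.

Local Notation cf := (curl_form Om sigma).
Local Notation wO u v := (vip Om (smul eps u) v).
Local Notation wD u v := (vip D (smul eps u) v).
Local Notation nrm := (Hcurl_norm Om).
Local Notation RE := (dual_norm Om X (state_residual Om sigma eps uN ENs)).
Local Notation RF := (dual_norm Om X (adjoint_residual Om D sigma eps Ed ENs FN)).

Let XL E : X E -> vL2 Om E. Proof. by move=> /XH[]. Qed.
Let LD E : vL2 Om E -> vL2 D E. Proof. exact: lmeasurableS_L2. Qed.

Let XB E G : X E -> X G -> X (E - G).
Proof. by move=> XE XG; rewrite addrC -scaleN1r; exact: X_lin. Qed.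

Let XZ a E : X E -> X (a *: E).
Proof. by move=> XE; rewrite -[a](subrK 1) scalerDl scale1r; exact: X_lin. Qed.

(** The set [A] is [Om] for the state residual and [D] for the adjoint one. The constant built from
    [c] and [k] witnesses continuity of the residual for [dual_norm_le] and then disappears. *)
Lemma residual_le u E G r A : lmeasurable A -> A `<=` Om -> vL2 A u -> X E ->
  r = (fun G => vip A (smul eps u) G - cf E G) -> X G ->
  `|r G| <= dual_norm Om X r * nrm G.
Proof.
move=> mA AO Lu XE rE XG.
have meA : lmeasurable_fun A eps by exact: measurable_funS me.
have ecA : {ae leb3, forall x, A x -> 0 <= eps x <= c} by apply: ae_leb3S ec => x H /AO.
have LA F : X F -> vL2 A F by move=> /XL; exact: lmeasurableS_L2.
apply: (@dual_norm_le _ _ oO bO _ _ (c * vL2norm A u + k * nrm E)) => //.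
- move=> a F XF; rewrite rE curl_formC (curl_formZl oO bO ms sk)//; last exact: XH.
  rewrite (curl_formC Om sigma F) -[a in LHS](subrK 1) scalerDl scale1r.
  by rewrite (weight_linr mA meA ecA)//; [ring|exact: LA|exact: LA].
- move=> F XF; rewrite rE; apply: le_trans (ler_normB _ _) _; rewrite mulrDl lerD//.
    apply: le_trans (weight_norm_le mA meA c0 ecA Lu (LA F XF)) _.
    rewrite ler_wpM2l ?mulr_ge0 ?sqrtr_ge0//.
    apply: le_trans (vL2norm_le_Hcurl Om F); rewrite ler_wsqrtr//.
    by apply: vip_subset => //; exact: XL.
  exact: (curl_form_norm_le oO k0 ms sk).
Qed.

Let UN : U uN. Proof. by case: opt_N. Qed.
Let Uh : U uh. Proof. by case: opt_h. Qed.
Let XEh : X Eh. Proof. by case: opt_h => _ []. Qed.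
Let XFh : X Fh. Proof. by case: opt_h => _ _ []. Qed.
Let XEN : X ENs. Proof. by case: opt_N => _ [/ENX]. Qed.
Let XFN : X FN. Proof. by case: opt_N => _ _ [/ENX]. Qed.
Let XEhat : X Ehat. Proof. by case: Ehat_def. Qed.
Let XFhat : X Fhat. Proof. by case: Fhat_def. Qed.

Local Notation eh := (Eh - Ed).
Local Notation eN := (ENs - Ed).
Local Notation s := (Eh - Ehat).
Local Notation a := (ENs - Ehat).
Local Notation w := (uh - uN).
Local Notation B := (CE + e_d).

Let Leh : vL2 D eh. Proof. by apply: vL2B => //; exact/LD/XL. Qed.
Let LeN : vL2 D eN. Proof. by apply: vL2B => //; exact/LD/XL. Qed.
Let Xs : X s. Proof. exact: XB. Qed.
Let Xa : X a. Proof. exact: XB. Qed.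
Let Lw : vL2 Om w. Proof. by apply: vL2B => //; exact: UL2. Qed.

(** By the equation of [Ehat], pairing with [a] in the curl-curl form is minus the state
    residual. *)
Lemma RE_le G : X G -> `|cf a G| <= RE * nrm G.
Proof.
move=> XG; have := @residual_le uN ENs G _ Om mO _ (UL2 UN) XEN erefl XG.
rewrite (curl_formBl oO bO ms sk); [|exact: XH|exact: XH].
by case: Ehat_def => _ -> // _; rewrite distrC; apply.
Qed.

Lemma RF_le G : X G -> `|wD eN G - cf FN G| <= RF * nrm G.
Proof. by move=> XG; exact: (@residual_le eN FN G _ D mD DO LeN XFN erefl XG). Qed.

Lemma observation_le E : X E -> nrm E <= CE -> vL2norm D (E - Ed) <= B.
Proof.
move=> XE EC; apply: le_trans (vL2norm_triangle mD (LD (XL XE)) LEd) _.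
apply: lerD => //; apply: le_trans EC; apply: le_trans (vL2norm_le_Hcurl Om E).
by rewrite ler_wsqrtr//; apply: vip_subset => //; exact: XL.
Qed.

Lemma vL2normD_le E : X E -> vL2norm D E <= nrm E.
Proof.
move=> XE; apply: le_trans (vL2norm_le_Hcurl Om E).
by rewrite ler_wsqrtr//; apply: vip_subset => //; exact: XL.
Qed.

(** Test the adjoint equation with [F] itself. The pair [(Z, W)] is free because [Fh] and [Fhat]
    live on the discrete spaces and [FN] on the reduced ones, and each needs coercivity under its
    own divergence constraint. *)
Lemma adjoint_norm_le (Z : set (vfield R)) (W : set (sfield R)) E F :
  coercive Om Z W sigma eps C -> Z `<=` X -> X E -> nrm E <= CE ->
  adjoint_system Om D Z W sigma eps Ed E F -> nrm F <= C * c * B.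
Proof.
move=> coer ZX XE EC [ZF Ftest Fdiv].
have := coer F ZF Fdiv; rewrite (Ftest F ZF) => H.
have LE : vL2 D (E - Ed) by apply: vL2B => //; exact/LD/XL.
have FD := vL2normD_le (ZX _ ZF).
have OB := observation_le XE EC.
have N0 : 0 <= nrm F by exact: sqrtr_ge0.
have B0 : 0 <= B by apply: le_trans OB; exact: sqrtr_ge0.
have : nrm F ^+ 2 <= C * c * B * nrm F.
  apply: (le_trans H); rewrite -!mulrA ler_wpM2l ?(ltW C0)//.
  apply: le_trans (ler_norm _) _.
  apply: le_trans (weight_norm_le mD meD c0 ecD LE (LD (XL (ZX _ ZF)))) _.
  by rewrite -mulrA ler_wpM2l// ler_pM// sqrtr_ge0.
have [->|n0] := eqVneq (nrm F) 0; first by rewrite !mulr_ge0// (ltW C0).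
by rewrite expr2 ler_pM2r// lt_def n0.
Qed.

Let nFh : nrm Fh <= C * c * B.
Proof. by case: opt_h => _ _ + _; exact: adjoint_norm_le. Qed.

Let nFhat : nrm Fhat <= C * c * B.
Proof. by move: Fhat_def; exact: adjoint_norm_le. Qed.

Let nFN : nrm FN <= C * c * B.
Proof. by case: opt_N => _ _ + _; exact: adjoint_norm_le. Qed.

Let B0 : 0 <= B.
Proof. by apply: le_trans (observation_le XEh Eh_le); exact: sqrtr_ge0. Qed.

Lemma costE u E : vL2 Om u -> X E -> cost Om D alpha eps Ed ud u E =
  2^-1 * wD (E - Ed) (E - Ed) + alpha / 2 * wO (u - ud) (u - ud).
Proof.
move=> Lu XE; rewrite /cost (vL2norm_sqrt_weight mD meD ecD).
  by rewrite (vL2norm_sqrt_weight mO me ec)//; exact: vL2B.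
by apply: vL2B => //; exact/LD/XL.
Qed.

Lemma state_diff G : X G -> cf s G = wO w G.
Proof.
move=> XG; rewrite (curl_formBl oO bO ms sk); [|exact: XH|exact: XH].
rewrite (weightBl mO me ec); [|exact: UL2|exact: UL2|exact: XL].
by case: opt_h => _ [_ -> // _] _ _; case: Ehat_def => _ -> // _.
Qed.

Lemma adjoint_state_error : `|wD eh a| <= RE * (C * c * B) /\ `|wD eN a| <= RE * (C * c * B).
Proof.
have RE0 : 0 <= RE by exact: dual_norm_ge0.
split.
  have <- : cf Fh a = wD eh a by case: opt_h => _ _ [_ H _] _; exact: H.
  rewrite (curl_formC Om sigma Fh a).
  exact: le_trans (RE_le XFh) (ler_wpM2l RE0 nFh).
have <- : cf Fhat a = wD eN a by case: Fhat_def => _ H _; exact: H.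
rewrite (curl_formC Om sigma Fhat a).
exact: le_trans (RE_le XFhat) (ler_wpM2l RE0 nFhat).
Qed.

(** Multiplication by [alpha] brings out the gradient of the reduced cost, [F + alpha * (v - ud)],
    whose weighted pairing with [u - v] is nonnegative. *)
Lemma variational_inequality u v F : vL2 Om u -> vL2 Om v -> vL2 Om F ->
  wO (u - v) (ud - alpha^-1 *: F - v) <= 0 -> - alpha * wO (u - v) (v - ud) <= wO (u - v) F.
Proof.
move=> Lu Lv LF; have Luv := vL2B mO Lu Lv.
have -> : ud - alpha^-1 *: F - v = (- alpha^-1) *: F - (v - ud).
  by rewrite opprB scaleNr addrA (addrC (- (_ *: _)) ud).
have LaF : vL2 Om ((- alpha^-1) *: F).
  by rewrite -[- alpha^-1](subrK 1) scalerDl scale1r; exact: vL2_lin.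
have Lvu := vL2B mO Lv Lud.
rewrite (weightBr mO me ec LaF Lvu Luv) (weightZr mO me ec _ LF Luv).
rewrite mulNr -opprD oppr_le0 => H; have := mulr_ge0 (ltW a0) H.
rewrite mulrDr mulrA mulfV ?gt_eqF// mul1r => {}H.
by rewrite mulNr lerNl -subr_ge0 opprK addrC.
Qed.

Lemma cost_upper : cost Om D alpha eps Ed ud uh Eh - cost Om D alpha eps Ed ud uN ENs
  <= RE * (C * c * B).
Proof.
have Lah := LD (XL Xa); have Lsh := LD (XL Xs); have Lsa := vL2B mD Lsh Lah.
have LFh := XL XFh; have Luh := UL2 Uh; have LuN := UL2 UN; have Lud' := vL2B mO Luh Lud.
rewrite !costE//.
have -> : eN = eh - (s - a) by exact: subr_swap.
have -> : uN - ud = (uh - ud) - w by rewrite opprB [RHS]addrC addrA subrK.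
rewrite (weight_sqrB mD meD ecD Leh Lsa) (weight_sqrB mO me ec Lud' Lw).
rewrite (weightBr mD meD ecD Lsh Lah Leh).
have V : - alpha * wO (uN - uh) (uh - ud) <= wO (uN - uh) Fh.
  by apply: variational_inequality => //; case: opt_h => _ _ _; apply.
have N x : vL2 Om x -> wO (uN - uh) x = - wO w x.
  by move=> Lx; rewrite !(weightBl mO me ec)// opprB.
(* The state difference tested with [Fh] meets the adjoint equation tested with [s]: this is the
   cancellation of the linear term. *)
have Fs : wO w Fh = wD eh s.
  by rewrite -(state_diff XFh) curl_formC; case: opt_h => _ _ [_ H _] _; exact: H.
rewrite (N _ Lud') (N _ LFh) Fs (vip_smulC Om eps w) in V.
have Psa := weight_ge0 mD meD ecD Lsa; have W0 := weight_ge0 mO me ec Lw.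
have := adjoint_state_error.1; rewrite ler_norml => /andP[H _].
rewrite lerNl in H.
have aW : 0 <= alpha / 2 * wO w w by rewrite mulr_ge0// divr_ge0// ltW.
exact: (upper_gap_arith _ _ V Psa aW H).
Qed.

(** The terms in rho cancel in [s], so coercivity applies and bounds its squared norm by
    [C * wO w s]. Cauchy-Schwarz in the weighted product then keeps [wO w w] itself, the quantity
    available in the cost. *)
Lemma state_diff_norm : nrm s ^+ 2 <= C ^+ 2 * c * wO w w.
Proof.
have Lsh := XL Xs; have W0 := weight_ge0 mO me ec Lw.
have n0 : 0 <= nrm s by exact: sqrtr_ge0.
have dvs : div_constraint Om Y eps s (fun=> 0).
  move=> phi Yphi; have Lg : vL2 Om (wgrad Om phi).
    by rewrite /wgrad; case: xgetP => [v _ []//|_]; exact: vL2_0.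
  rewrite (weightBl mO me ec (XL XEh) (XL XEhat) Lg).
  have [_ [_ _ -> //] _ _] := opt_h; have [_ _ -> //] := Ehat_def.
  rewrite subrr /ip (eq_Rintegral _ (g := fun=> 0)); last by move=> x _; rewrite mul0r.
  by rewrite Rintegral_cst// mul0r oppr0.
have H := coerX Xs dvs; rewrite (state_diff Xs) in H.
have CS := weight_cauchy_schwarz mO me ec Lw Lsh.
have Ws : wO s s <= c * nrm s ^+ 2.
  apply: le_trans (weight_le mO me ec Lsh) _; rewrite ler_wpM2l//.
  by rewrite lerXn2r ?nnegrE ?sqrtr_ge0// vL2norm_le_Hcurl.
have H2 : (nrm s ^+ 2) ^+ 2 <= C ^+ 2 * (wO w w * (c * nrm s ^+ 2)).
  apply: (@le_trans _ _ ((C * wO w s) ^+ 2)).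
    have P0 : 0 <= C * wO w s by apply: le_trans H; exact: sqr_ge0.
    by apply: lerXn2r => //; rewrite nnegrE ?sqr_ge0.
  rewrite exprMn ler_wpM2l ?sqr_ge0//; apply: le_trans CS _.
  by rewrite ler_wpM2l.
have [->|ns] := eqVneq (nrm s) 0; first by rewrite expr0n/= mulr_ge0// mulr_ge0// sqr_ge0.
have np : 0 < nrm s ^+ 2 by rewrite exprn_gt0// lt_def ns.
rewrite -(ler_pM2r np) -expr2; apply: le_trans H2 _.
by rewrite le_eqVlt; apply/orP; left; apply/eqP; ring.
Qed.

Lemma cost_lower : cost Om D alpha eps Ed ud uN ENs - cost Om D alpha eps Ed ud uh Eh
  <= RE * (C * c * B) + RF * (C ^+ 2 * c ^+ 2 * B / alpha).
Proof.
have Lah := LD (XL Xa); have Lsh := LD (XL Xs); have Las := vL2B mD Lah Lsh.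
have Luh := UL2 Uh; have LuN := UL2 UN; have Lud' := vL2B mO LuN Lud.
have Lz := vL2B mO LuN Luh.
have LFN := XL XFN; have LFhat := XL XFhat.
set f := FN - Fhat; have Xf : X f by exact: XB.
have Lf := XL Xf.
have W0 := weight_ge0 mO me ec Lw.
rewrite !costE//.
have -> : eh = eN - (a - s) by exact: subr_swap.
have -> : uh - ud = (uN - ud) - (uN - uh) by rewrite opprB [RHS]addrC addrA subrK.
rewrite (weight_sqrB mD meD ecD LeN Las) (weight_sqrB mO me ec Lud' Lz).
rewrite (weightBr mD meD ecD Lah Lsh LeN).
have V : - alpha * wO w (uN - ud) <= wO w FN.
  by apply: variational_inequality => //; case: opt_N => _ _ _; apply.
have N x : vL2 Om x -> wO (uN - uh) x = - wO w x.
  by move=> Lx; rewrite !(weightBl mO me ec)// opprB.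
have Wz : wO (uN - uh) (uN - uh) = wO w w.
  by rewrite (N _ Lz) vip_smulC (N _ Lw) opprK.
have Vz : wO (uN - ud) (uN - uh) = - wO w (uN - ud) by rewrite vip_smulC N.
have fE : wO w f = wO w FN - wO w Fhat by exact: (weightBr mO me ec).
have Fhs : wO w Fhat = wD eN s.
  by rewrite -(state_diff XFhat) curl_formC; case: Fhat_def => _ H _; exact: H.
(* Here [wO w FN] is [cf s FN] and [wO w Fhat] is [wD eN s], so [wO w f] is minus the adjoint
   residual at [s]. *)
have ft : wO w f ^+ 2 <= RF ^+ 2 * nrm s ^+ 2.
  have := RF_le Xs; rewrite -Fhs => H.
  rewrite -exprMn -(real_normK (num_real (wO w f))) lerXn2r ?nnegrE//.
    by rewrite mulr_ge0 ?sqrtr_ge0// dual_norm_ge0.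
  rewrite fE distrC; apply: le_trans H.
  by rewrite -(state_diff XFN) curl_formC.
have f2 : wO w f ^+ 2 <= wO w w * (c * (2 * (C * c * B)) ^+ 2).
  apply: le_trans (weight_cauchy_schwarz mO me ec Lw Lf) _; rewrite ler_wpM2l//.
  apply: le_trans (weight_le mO me ec Lf) _; rewrite ler_wpM2l//.
  rewrite lerXn2r ?nnegrE ?sqrtr_ge0 ?mulr_ge0 ?(ltW C0)//.
  apply: le_trans (vL2norm_triangle mO LFN LFhat) _.
  have h1 := le_trans (vL2norm_le_Hcurl Om FN) nFN.
  have h2 := le_trans (vL2norm_le_Hcurl Om Fhat) nFhat.
  by rewrite mulr_natl mulr2n; exact: lerD.
have Pas := weight_ge0 mD meD ecD Las.
have RF0 : 0 <= RF by exact: dual_norm_ge0.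
have := adjoint_state_error.2; rewrite ler_norml => /andP[_ Ha].
have sn := state_diff_norm.
rewrite Wz Vz.
have Hq := quadratic_gap a0 c0 (ltW C0) B0 RF0 W0 ft sn f2.
rewrite fE Fhs in Hq.
exact: (lower_gap_arith _ _ V Pas Ha Hq).
Qed.

End CostGap.

(** * Comparison with the constants of the estimate, and null domains *)

Lemma measurable_inv (R : realType) : measurable_fun [set: R] (@GRing.inv R).
Proof.
have m0 : measurable [set 0 : R] by exact: measurable_set1.
rewrite -(setUv [set 0]); apply/measurable_funU => //; first exact: measurableC.
split; first exact: measurable_fun_set1.
apply: open_continuous_measurable_fun; first exact/closed_openC/closed_eq.
move=> x; rewrite inE /= => /eqP x0; exact: inv_continuous.
Qed.

Lemma vip_null (R : realType) (A : set 'rV[R]_3) (u v : vfield R) : lmeasurable A ->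
  vL2 A u -> vL2 A v -> {ae leb3, forall x, ~ A x} -> vip A u v = 0.
Proof.
move=> mA Lu Lv nA; rewrite (vip_ae_eql mA Lu (vL2_0 A) Lv).
  rewrite /vip (eq_Rintegral _ (g := fun=> 0)) ?Rintegral_cst// ?mul0r// => x _.
  by rewrite /dot big1// => i _; rewrite mxE mul0r.
by apply: ae_leb3S nA => x nA /nA.
Qed.

(** Bounds holding almost everywhere on a null domain do not force [lo <= hi], whence the second
    alternative: with both residuals zero the one-sided bounds give [J1 = J2]. In the first,
    [hi / lo] is at least 1. *)
Lemma gap_estimate (R : rcfType) (J1 J2 r1 r2 C c lo hi B alpha m : R) :
  0 < alpha -> 0 < lo -> 0 <= C -> 0 <= B -> 0 <= m -> 0 <= r1 -> 0 <= r2 ->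
  (lo <= hi /\ c = hi) \/ (r1 = 0 /\ r2 = 0) ->
  J1 - J2 <= r1 * (C * c * B) ->
  J2 - J1 <= r1 * (C * c * B) + r2 * (C ^+ 2 * c ^+ 2 * B / alpha) ->
  `|J1 - J2| <=
    C * hi * (B * (C * (Num.sqrt alpha)^-1 * lo^-1 * hi ^+ 2 + 1) +
      Num.sqrt alpha * lo^-1 * hi * m) * r1 +
    C * hi ^+ 2 * (C * alpha^-1 * lo^-1 * hi * B + lo^-1 * m) * r2.
Proof.
move=> a0 lo0 C0 B0 m0 r10 r20 [[lohi ->]|[-> ->]]; last first.
  rewrite !mul0r !mulr0 addr0 => up low.
  have -> : J1 = J2 by apply/eqP; rewrite eq_le -subr_le0 up /= -subr_le0.
  by rewrite subrr normr0.
have hi0 := lt_le_trans lo0 lohi.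
have li0 : 0 <= lo^-1 by rewrite invr_ge0 ltW.
have ai0 : 0 <= alpha^-1 by rewrite invr_ge0 ltW.
have si0 : 0 <= (Num.sqrt alpha)^-1 by rewrite invr_ge0 sqrtr_ge0.
have hl : 1 <= lo^-1 * hi by rewrite mulrC ler_pdivlMr// mul1r.
have h0 := ltW hi0.
move=> up low; set d1 := C * hi * _; set d2 := C * hi ^+ 2 * _.
have E1 : r1 * (C * hi * B) <= d1 * r1.
  rewrite mulrC ler_wpM2r// /d1 ler_wpM2l ?mulr_ge0// mulrDr mulr1 -addrA addrCA lerDl.
  by rewrite addr_ge0// !mulr_ge0// ?sqrtr_ge0// exprn_ge0.
(* Multiplying by [lo^-1 * hi >= 1] turns the coefficient into the first summand of [d2]; the other
   summand is nonnegative. *)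
have E2 : r2 * (C ^+ 2 * hi ^+ 2 * B / alpha) <= d2 * r2.
  rewrite mulrC ler_wpM2r//.
  apply: (@le_trans _ _ (C ^+ 2 * hi ^+ 2 * B / alpha * (lo^-1 * hi))).
    by rewrite ler_peMr// !mulr_ge0// exprn_ge0.
  rewrite /d2 mulrDr; set d3 := _ * (lo^-1 * m).
  have d30 : 0 <= d3 by rewrite /d3 !mulr_ge0// exprn_ge0.
  have -> : C ^+ 2 * hi ^+ 2 * B / alpha * (lo^-1 * hi) =
    C * hi ^+ 2 * (C * alpha^-1 * lo^-1 * hi * B) by ring.
  by rewrite lerDl.
have d2r : 0 <= d2 * r2.
  by apply: le_trans E2; rewrite !mulr_ge0// exprn_ge0.
rewrite ler_norml; apply/andP; split.
  by rewrite lerNl opprB (le_trans low)// lerD.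
by rewrite (le_trans up)// (le_trans E1)// lerDl.
Qed.

Theorem theorem6p4 (R : realType) (p : nat)
  (* domain, parameters, observation region *)
  (Om D : set 'rV[R]_3) (P : set 'rV[R]_p) (alpha : R)
  (Om_open : open Om) (Om_bounded : bounded_set Om) (Om_conn : connected Om)
  (Om_lip : lipschitz_boundary Om)
  (P_compact : compact P)
  (D_sub : D `<=` Om) (D_meas : lmeasurable D)
  (alpha_gt0 : 0 < alpha)
  (* scalar data *)
  (rho eps sigma : 'rV[R]_p -> 'rV[R]_3 -> R)
  (rho_lo rho_hi eps_lo eps_hi sigma_lo sigma_hi : R)
  (rho_meas : forall mu, P mu -> lmeasurable_fun Om (rho mu))
  (eps_meas : forall mu, P mu -> lmeasurable_fun Om (eps mu))
  (sigma_meas : forall mu, P mu -> lmeasurable_fun Om (sigma mu))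
  (rho_bnd : forall mu, P mu ->
     {ae leb3, forall x, Om x -> rho_lo <= rho mu x <= rho_hi})
  (eps_bnd : forall mu, P mu ->
     {ae leb3, forall x, Om x -> eps_lo <= eps mu x <= eps_hi})
  (sigma_bnd : forall mu, P mu ->
     {ae leb3, forall x, Om x -> sigma_lo <= sigma mu x <= sigma_hi})
  (eps_lo_gt0 : 0 < eps_lo) (sigma_lo_gt0 : 0 < sigma_lo)
  (eps_smooth : forall mu, P mu -> piecewise_smooth Om (eps mu))
  (* control bounds, desired state and control *)
  (u_lo u_hi : 'rV[R]_3) (Ed ud : 'rV[R]_p -> 'rV[R]_3 -> 'rV[R]_3)
  (e_d u_d : R)
  (Ed_L2 : forall mu, P mu -> vL2 D (Ed mu))
  (ud_L2 : forall mu, P mu -> vL2 Om (ud mu))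
  (Ed_bnd : forall mu, P mu -> vL2norm D (Ed mu) <= e_d)
  (ud_bnd : forall mu, P mu -> vL2norm Om (ud mu) <= u_d)
  (Ed_div : forall mu, P mu -> wdiv_eq D (smul (eps mu) (Ed mu)) (rho mu))
  (* finite element and reduced basis spaces *)
  (I : Type) (T : I -> mesh) (T_qu : quasi_uniform_family Om T) (h : I)
  (EN : set ('rV[R]_3 -> 'rV[R]_3)) (VN : set ('rV[R]_3 -> R))
  (EN_lin : linear_subspace EN) (EN_sub : EN `<=` nedelec_space Om (T h))
  (VN_lin : linear_subspace VN) (VN_sub : VN `<=` lagrange_space Om (T h))
  (* coercivity constant *)
  (Csigma : R) (Csigma_gt0 : 0 < Csigma)
  (coer_h : forall mu, P mu ->
     coercive Om (nedelec_space Om (T h)) (lagrange_space Om (T h))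
       (sigma mu) (eps mu) Csigma)
  (coer_N : forall mu, P mu ->
     coercive Om EN VN (sigma mu) (eps mu) Csigma)
  (* stability constant and C_E *)
  (Cstab CE : R) (Cstab_gt0 : 0 < Cstab)
  (CE_def : CE = Cstab * Num.sqrt (vol Om) * (rho_hi + enorm u_hi))
  (stab : forall mu u E, P mu -> Uad P Om eps u_lo u_hi u ->
     state_system Om (H0curl Om) (H10 Om) (sigma mu) (eps mu) (rho mu) u E ->
     Hcurl_norm Om E <= Cstab * (vL2norm Om u + L2norm Om (rho mu)) <= CE)
  (stab_h : forall mu u E, P mu -> Uad P Om eps u_lo u_hi u ->
     state_system Om (nedelec_space Om (T h)) (lagrange_space Om (T h))
       (sigma mu) (eps mu) (rho mu) u E ->
     Hcurl_norm Om E <= CE)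
  (stab_N : forall mu u E, P mu -> Uad P Om eps u_lo u_hi u ->
     state_system Om EN VN (sigma mu) (eps mu) (rho mu) u E ->
     Hcurl_norm Om E <= CE)
  (* solutions of the discrete and of the reduced optimality systems *)
  (mu : 'rV[R]_p) (mu_P : P mu)
  (uh Eh Fh uN ENs FN : 'rV[R]_3 -> 'rV[R]_3)
  (opt_h : optimality_system Om D (Uad P Om eps u_lo u_hi)
     (nedelec_space Om (T h)) (lagrange_space Om (T h)) alpha
     (sigma mu) (eps mu) (rho mu) (Ed mu) (ud mu) uh Eh Fh)
  (opt_N : optimality_system Om D (Uad P Om eps u_lo u_hi) EN VN alpha
     (sigma mu) (eps mu) (rho mu) (Ed mu) (ud mu) uN ENs FN)
  (* auxiliary fields *)
  (Ehat Fhat : 'rV[R]_3 -> 'rV[R]_3)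
  (Ehat_def : state_system Om (nedelec_space Om (T h)) (lagrange_space Om (T h))
     (sigma mu) (eps mu) (rho mu) uN Ehat)
  (Fhat_def : adjoint_system Om D (nedelec_space Om (T h)) (lagrange_space Om (T h))
     (sigma mu) (eps mu) (Ed mu) ENs Fhat) :
  let RE := dual_norm Om (nedelec_space Om (T h))
    (state_residual Om (sigma mu) (eps mu) uN ENs) in
  let RF := dual_norm Om (nedelec_space Om (T h))
    (adjoint_residual Om D (sigma mu) (eps mu) (Ed mu) ENs FN) in
  let deltaE := Csigma * eps_hi *
    ((CE + e_d) *
       (Csigma * (Num.sqrt alpha)^-1 * eps_lo^-1 * eps_hi ^+ 2 + 1) +
     Num.sqrt alpha * eps_lo^-1 * eps_hi *
       (enorm u_hi * Num.sqrt (vol Om) + u_d)) in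
  let deltaF := Csigma * eps_hi ^+ 2 *
    (Csigma * alpha^-1 * eps_lo^-1 * eps_hi * (CE + e_d) +
     eps_lo^-1 * (enorm u_hi * Num.sqrt (vol Om) + u_d)) in
  `| cost Om D alpha (eps mu) (Ed mu) (ud mu) uh Eh -
     cost Om D alpha (eps mu) (Ed mu) (ud mu) uN ENs |
    <= deltaE * RE + deltaF * RF.
Proof.
lazy zeta.
have mO := open_lmeasurable Om_open.
(* The maximum makes [c] nonnegative before anything is known about the order of [eps_lo] and
   [eps_hi]. *)
pose c := Num.max eps_lo eps_hi; pose k := sigma_lo^-1.
have c0 : 0 <= c by rewrite le_max (ltW eps_lo_gt0).
have k0 : 0 <= k by rewrite invr_ge0 ltW.
have ec : {ae leb3, forall x, Om x -> 0 <= eps mu x <= c}.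
  apply: ae_leb3S (eps_bnd _ mu_P) => x /[apply] /andP[e1 e2].
  by rewrite (le_trans (ltW eps_lo_gt0) e1) le_max e2 orbT.
have sk : {ae leb3, forall x, Om x -> 0 <= recip (sigma mu) x <= k}.
  apply: ae_leb3S (sigma_bnd _ mu_P) => x /[apply] /andP[s1 _].
  have s0 := lt_le_trans sigma_lo_gt0 s1.
  by rewrite /recip invr_ge0 (ltW s0) lef_pV2 ?posrE.
have ms : lmeasurable_fun Om (recip (sigma mu)).
  exact: measurableT_comp (@measurable_inv R) (sigma_meas _ mu_P).
have me := eps_meas _ mu_P.
pose X := nedelec_space Om (T h).
have XH : X `<=` Hcurl Om by move=> E; exact: nedelec_Hcurl.
have X_lin a E G : X E -> X G -> X (a *: E + G) by exact: nedelec_lin.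
have UL2 : Uad P Om eps u_lo u_hi `<=` vL2 Om by move=> u [].
have Eh_le : Hcurl_norm Om Eh <= CE.
  by case: opt_h => Uh Sh _ _; exact: stab_h Sh.
have EN_le : Hcurl_norm Om ENs <= CE.
  by case: opt_N => UN SN _ _; exact: stab_N SN.
have up := cost_upper Om_open Om_bounded D_sub D_meas alpha_gt0 c0 k0 Csigma_gt0 me ms
  ec sk (Ed_L2 _ mu_P) (ud_L2 _ mu_P) (Ed_bnd _ mu_P) XH X_lin EN_sub UL2 (coer_h _ mu_P)
  opt_h opt_N Ehat_def Fhat_def Eh_le EN_le.
have lo := cost_lower Om_open Om_bounded D_sub D_meas alpha_gt0 c0 k0 Csigma_gt0 me ms
  ec sk (Ed_L2 _ mu_P) (ud_L2 _ mu_P) (Ed_bnd _ mu_P) XH X_lin EN_sub UL2 (coer_h _ mu_P)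
  (coer_N _ mu_P) opt_h opt_N Ehat_def Fhat_def Eh_le EN_le.
have CE0 : 0 <= CE by apply: le_trans Eh_le; exact: sqrtr_ge0.
have ed0 : 0 <= e_d by apply: le_trans (Ed_bnd _ mu_P); exact: sqrtr_ge0.
have ud0 : 0 <= u_d by apply: le_trans (ud_bnd _ mu_P); exact: sqrtr_ge0.
apply: (gap_estimate alpha_gt0 eps_lo_gt0 (ltW Csigma_gt0) _ _ _ _ _ up lo).
- exact: addr_ge0.
- by rewrite addr_ge0// mulr_ge0// sqrtr_ge0.
- exact: dual_norm_ge0.
- exact: dual_norm_ge0.
have [e12|e21] := leP eps_lo eps_hi.
  by left; split => //; rewrite /c max_r.
(* Contradictory bounds on eps leave almost no point in [Om]; every integral over [Om] or [D] then
   vanishes, and with them both residuals. *)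
right.
have nO : {ae leb3, forall x, ~ Om x}.
  apply: ae_leb3S (eps_bnd _ mu_P) => x H /H /andP[e1 e2].
  by move: e21; rewrite ltNge (le_trans e1 e2).
have nD : {ae leb3, forall x, ~ D x} by apply: ae_leb3S nO => x nO /D_sub.
have cf0 E G : curl_form Om (sigma mu) E G = 0.
  apply: vip_null => //; last exact: vL2_wcurl.
  by apply: (vL2_weight mO ms sk); exact: vL2_wcurl.
split; apply: dual_norm_eq0 => G XG.
  rewrite /state_residual cf0 subr0.
  apply: vip_null => //; last by have [] := XH _ XG.
  by apply: (vL2_weight mO me ec); apply: UL2; case: opt_N.
have LD E : X E -> vL2 D E.
  by move=> /XH[LE _]; exact: lmeasurableS_L2 D_meas D_sub LE.
rewrite /adjoint_residual cf0 subr0; apply: vip_null => //; last exact: LD.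
have meD : lmeasurable_fun D (eps mu) by exact: measurable_funS me.
have ecD : {ae leb3, forall x, D x -> 0 <= eps mu x <= c}.
  by apply: ae_leb3S ec => x H /D_sub.
apply: (vL2_weight D_meas meD ecD); apply: vL2B => //; last exact: Ed_L2.
by apply: LD; case: opt_N => _ [/EN_sub].
Qed.
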